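(* Let $\{\lambda_k^\varepsilon\}_{k\ge1}$ be the eigenvalues of $\mathcal{S}_\varepsilon$, enumerated in increasing order counting multiplicity. Then: (i) for each $k$, $\lambda_k^\varepsilon$ is a continuous function of $\varepsilon\in(0,1)$; (ii) for each $k$, $\lambda_k^\varepsilon$ is bounded from above as $\varepsilon\to0$; (iii) if $\Psi$ changes sign and $|\alpha|$ is large enough (depending on $\Psi$), then the spectrum of $\mathcal{S}_\varepsilon$ is unbounded from below as $\varepsilon\to0$; in particular, there is a constant $c>0$ such that $\lambda_1^\varepsilon\le -c\,\varepsilon^{-4}$ for all sufficiently small $\varepsilon>0$; (iv) there is at most a finite number $N^-$ of indices $k$ for which $\lambda_k^\varepsilon\to-\infty$ as $\varepsilon\to0$.
   Context: Let $a<0<b$ and let $U$ be a smooth real-valued function on $[a,b]$. $C_0^\infty(-1,1)$ denotes the real-valued $C^\infty$ functions on $\mathbb{R}$ supported in $[-1,1]$. Let $\Psi,\Phi,\Upsilon_1,\Upsilon_2\in C_0^\infty(-1,1)$ with $\operatorname{supp}\Psi=[-1,1]$, and let $\alpha,\beta,\gamma_1,\gamma_2\in\mathbb{R}$. For $\varepsilon\in(0,1)$ put $$\Psi_\varepsilon(x)=\alpha\varepsilon^{-4}\Psi(x/\varepsilon)+\beta\varepsilon^{-3}\Phi(x/\varepsilon)+\gamma_1\varepsilon^{-2}\Upsilon_1(x/\varepsilon)+\gamma_2\varepsilon^{-1}\Upsilon_2(x/\varepsilon).$$ $\mathcal{S}_\varepsilon$ is the operator in $L_2(a,b)$ given by $\mathcal{S}_\varepsilon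 f=f^{(4)}+Uf+\Psi_\varepsilon f$ with domain $\{f\in W_2^4(a,b): f(a)=f'(a)=0,\ f(b)=f'(b)=0\}$. It is self-adjoint, and its spectrum is real and discrete. *)

(* Defs.v *)
From HB Require Import structures.
From mathcomp Require Import all_boot all_order all_algebra complex.
From mathcomp Require Import all_classical all_reals all_analysis.

Set Implicit Arguments.
Unset Strict Implicit.
Unset Printing Implicit Defensive.
Import Order.TTheory GRing.Theory Num.Theory.
Import numFieldNormedType.Exports.

Local Open Scope classical_set_scope.
Local Open Scope ring_scope.
Local Open Scope complex_scope.

Section RealData.
Context {R : realType}.

(* C^oo([a, b]): all derivatives exist in the interior and extend continuously
   to the closed interval; the values of f outside [a, b] are irrelevant. *)
Definition smooth_on (a b : R) (f : R -> R) : Prop :=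
  exists D : nat -> R -> R,
    [/\ {in `[a, b], D 0%N =1 f},
        forall n, {within `[a, b], continuous (D n)} &
        forall n, {in `]a, b[, forall x, is_derive x (1 : R) (D n) (D n.+1 x)}].

Definition tsupp (f : R -> R) : set R := closure [set x | f x != 0].

(* The space written C_0^oo(-1, 1): the support may touch -1 and 1. *)
Definition test_fun (f : R -> R) : Prop :=
  (forall n x, derivable (derive1n n f) x (1 : R)) /\ tsupp f `<=` `[-1, 1].

Definition changes_sign (f : R -> R) : Prop :=
  (exists x, 0 < f x) /\ (exists x, f x < 0).

Definition Psi_eps (Psi Phi Ups1 Ups2 : R -> R) (alpha beta gamma1 gamma2 : R)
    (eps x : R) : R :=
  alpha * eps ^- 4 * Psi (x / eps) + beta * eps ^- 3 * Phi (x / eps)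
  + gamma1 * eps ^- 2 * Ups1 (x / eps) + gamma2 * eps^-1 * Ups2 (x / eps).

End RealData.

(* Functions on [a, b] are represented by functions R -> R[i] whose values
   outside [a, b] are irrelevant. *)
Section Operators.
Context {R : realType}.
Variables a b : R.
Local Notation mu := (@lebesgue_measure R).
Local Notation fct := (R -> R[i]).

Definition L2normsq (f : fct) : \bar R :=
  (\int[mu]_(x in `[a, b]) (complex.Re (f x) ^+ 2 + complex.Im (f x) ^+ 2)%:E)%E.

Definition L2 (f : fct) : Prop :=
  [/\ measurable_fun `[a, b] (fun x => complex.Re (f x)),
      measurable_fun `[a, b] (fun x => complex.Im (f x)) & (L2normsq f < +oo)%E].

(* u is absolutely continuous on [a, b], with almost everywhere derivative v *)
Definition ac_deriv_real (u v : R -> R) : Prop :=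
  mu.-integrable `[a, b] (EFin \o v) /\
  {in `[a, b], forall x, u x = u a + \int[mu]_(t in `[a, x]) v t}.

Definition ac_deriv (u v : fct) : Prop :=
  ac_deriv_real (fun x => complex.Re (u x)) (fun x => complex.Re (v x)) /\
  ac_deriv_real (fun x => complex.Im (u x)) (fun x => complex.Im (v x)).

(* f is the C^{n-1} representative of an element of W_2^n(a, b) and
   d 0, ..., d n are its successive derivatives: for j < n, d j is absolutely
   continuous with derivative d j.+1, so that d j is the classical derivative
   f^(j) on [a, b], and d n = f^(n) almost everywhere. *)
Definition sobolev_derivs (n : nat) (f : fct) (d : nat -> fct) : Prop :=
  [/\ {in `[a, b], d 0%N =1 f},
      forall j, (j < n)%N -> ac_deriv (d j) (d j.+1) &
      L2 (d n)].

(* Graph of f |-> f^(4) + U f + P f on the functions of W_2^4(a, b) satisfying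
   the clamped boundary conditions; the image is determined almost everywhere. *)
Definition op_graph (U P : R -> R) (f g : fct) : Prop :=
  exists d : nat -> fct,
    [/\ sobolev_derivs 4 f d,
        d 0%N a = 0 /\ d 1%N a = 0,
        d 0%N b = 0 /\ d 1%N b = 0 &
        {ae mu, forall x, x \in `[a, b] ->
           g x = d 4%N x + (U x)%:C * f x + (P x)%:C * f x}].

(* Operators in L_2(a, b; C) are given by their graphs T, whose first
   components are taken to be continuous on [a, b], so that equality of elements
   of the domain is equality on [a, b]. *)

Definition eigenspace (T : fct -> fct -> Prop) (z : R[i]) : set fct :=
  [set f | T f (fun x => z * f x)].

Definition has_dim (E : set fct) (n : nat) : Prop :=
  exists e : 'I_n -> fct,
    [/\ forall i, E (e i),
        forall c : 'I_n -> R[i],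
          {in `[a, b], forall x, \sum_(i < n) c i * e i x = 0} ->
          forall i, c i = 0 &
        forall f, E f -> exists c : 'I_n -> R[i],
          {in `[a, b], forall x, f x = \sum_(i < n) c i * e i x}].

(* lam lists all the eigenvalues of T in nondecreasing order, each repeated
   according to its (complex) multiplicity; the case n = 0 says that a number
   which is not an eigenvalue is not listed. *)
Definition eigenvalue_enum (T : fct -> fct -> Prop) (lam : nat -> R) : Prop :=
  nondecreasing_seq lam /\
  forall z : R[i], exists n : nat,
    has_dim (eigenspace T z) n /\ ([set k | (lam k)%:C = z] #= `I_n)%card.

(* T - z maps the domain of T bijectively onto L_2(a, b), with bounded inverse *)
Definition resolvent_set (T : fct -> fct -> Prop) : set R[i] :=
  [set z | exists C : R, forall g, L2 g ->
     exists f, [/\ T f (fun x => z * f x + g x),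
       (L2normsq f <= C%:E * L2normsq g)%E &
       forall f', T f' (fun x => z * f' x + g x) -> {in `[a, b], f' =1 f}]].

Definition spectrum (T : fct -> fct -> Prop) : set R[i] := ~` resolvent_set T.

End Operators.

(* Main.v *)
Require Import Defs.
From HB Require Import structures.
From mathcomp Require Import all_boot all_order all_algebra complex.
From mathcomp Require Import all_classical all_reals all_analysis.
From mathcomp Require Import measurable_realfun.
From mathcomp Require Import ring lra.

Set Implicit Arguments.
Unset Strict Implicit.
Unset Printing Implicit Defensive.
Import Order.TTheory GRing.Theory Num.Theory.
Import numFieldNormedType.Exports.

Local Open Scope classical_set_scope.
Local Open Scope ring_scope.
Local Open Scope complex_scope.

(** With [h = f''] and [L h] the double primitive of [h], the clamped domain is
    [h] orthogonal to the affine functions, and the quadratic form of the operator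
    is [|h|^2 + <V L h, L h>].  Since [L] is compact, this form has a minimiser
    with [|L h| = 1] under finitely many orthogonality constraints, and the
    minimiser is an eigenfunction.  Hence, for any list of all the eigenvalues:
    [lam k <= M] as soon as the form is at most [M] on a [k+1]-dimensional space of
    clamped functions, while the first [k+1] eigenfunctions span a space on which
    the form is at most [lam k].
    (i) These two facts give [|lam k e - lam k e'| <= sup |Psi_e - Psi_e'|].
    (ii) Use [k+1] disjoint bumps supported in [b/2, b], where [Psi_e] vanishes.
    (iii) Use one bump of width of order [e] where [alpha Psi(x/e)] is negative:
    both terms of the form are then of order [e^-4].
    (iv) If [f] and [f'] vanish on a grid of [n] points of [-2e, 2e], then
    [f^2 <= (4e/n)^3 |f''|^2] there, so that for [n] large, independently of [e],
    [|f''|^2] dominates the singular potential; this costs [2n] linear conditions. *)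

(** * Pre-Hilbert spaces *)

(** Continuous functions with the [L_2] product are not complete, and the product is only
    semidefinite because values off [[a, b]] are free. So a minimising sequence need not have a
    limit in the space; instead the Euler equation expresses the minimiser through the limit of
    [L u_n], which compactness does supply. The unknown [h = f''] makes the form the identity plus a
    compact perturbation. No eigenfunction expansion is proved. The bound [lam k <= M] comes from a
    count: a minimiser below [lam k], orthogonal to [k] eigenfunctions, would make an eigenspace
    larger than the number of times its eigenvalue is listed. Since the listed multiplicities are
    complex while the minimisation is real, both counts pass between real and complex combinations.
    In (iii) the bump energy and the potential have the same order in [e], so their balance depends
    on [Psi] and [|alpha|] alone. In (iv) the condition on the grid is free of [e], since the powers
    of [e] cancel. *)

Lemma discriminant_le0 {R : realFieldType} (A B C : R) :
  (forall t, 0 <= A + 2 * t * B + t ^+ 2 * C) -> B ^+ 2 <= A * C.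
Proof.
move=> h; have A0 : 0 <= A by have := h 0; rewrite !(mulr0, mul0r, expr0n, addr0).
have [C0|C0] := eqVneq C 0.
  have [->|B0] := eqVneq B 0; first by rewrite C0 mulr0 expr0n.
  have := h (- (A + 1) / (2 * B)); rewrite C0.
  have -> : A + 2 * (- (A + 1) / (2 * B)) * B
      + (- (A + 1) / (2 * B)) ^+ 2 * 0 = - 1 by field.
  lra.
have Cgt : 0 < C.
  rewrite lt_neqAle eq_sym C0 /= leNgt; apply/negP => Cn.
  (* For this [t], [t * C <= - (1 + A + 2 * |B|)], so the quadratic is at most [A - t * (1 + A)],
     which is negative because [t >= 1]. *)
  pose t := (1 + A + `|B| * 2) / - C + 1.
  have t1 : 1 <= t.
    rewrite /t lerDr; apply: divr_ge0; last by rewrite oppr_ge0 ltW.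
    by have := normr_ge0 B; lra.
  have tC : t * C <= - (1 + A + `|B| * 2).
    rewrite /t mulrDl mul1r.
    have -> : (1 + A + `|B| * 2) / - C * C = - (1 + A + `|B| * 2) by field.
    by rewrite gerDl ltW.
  have := h t; have Bl := ler_norm B.
  have t0 : 0 <= t by lra.
  have := ler_wpM2l t0 tC; have := ler_wpM2l t0 Bl.
  have := mulr_ge0 (_ : 0 <= t - 1) A0; rewrite subr_ge0 t1 => /(_ isT).
  set b := `|B|; rewrite expr2; lra.
have := h (- B / C).
have -> : A + 2 * (- B / C) * B + (- B / C) ^+ 2 * C = (A * C - B ^+ 2) / C by field.
by rewrite pmulr_lge0 ?invr_gt0 // subr_ge0.
Qed.

Section PreHilbert.
Context {R : realType} {H : lmodType R}.
Variable dot : H -> H -> R.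
Hypothesis dotC : forall u v, dot u v = dot v u.
Hypothesis dotl : forall k u v w, dot (k *: u + v) w = k * dot u w + dot v w.
Hypothesis dot_ge0 : forall u, 0 <= dot u u.

Lemma dotDl u v w : dot (u + v) w = dot u w + dot v w.
Proof. by have := dotl 1 u v w; rewrite scale1r mul1r. Qed.

Lemma dot0l w : dot 0 w = 0.
Proof. by have := dotDl 0 0 w; rewrite addr0; lra. Qed.

Lemma dotZl k u w : dot (k *: u) w = k * dot u w.
Proof. by have := dotl k u 0 w; rewrite addr0 dot0l addr0. Qed.

Lemma dotNl u w : dot (- u) w = - dot u w.
Proof. by rewrite -scaleN1r dotZl mulN1r. Qed.

Lemma dotBl u v w : dot (u - v) w = dot u w - dot v w.
Proof. by rewrite dotDl dotNl. Qed.

Lemma dotDr u v w : dot u (v + w) = dot u v + dot u w.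
Proof. by rewrite dotC dotDl !(dotC u). Qed.

Lemma dotZr k u w : dot u (k *: w) = k * dot u w.
Proof. by rewrite dotC dotZl (dotC u). Qed.

Lemma dot_suml (I : Type) (s : seq I) (F : I -> H) w :
  dot (\sum_(i <- s) F i) w = \sum_(i <- s) dot (F i) w.
Proof.
by elim/big_rec2: _ => [|i x y _ <-]; rewrite ?dot0l // dotDl.
Qed.

Definition nrm u := Num.sqrt (dot u u).

Lemma nrm_ge0 u : 0 <= nrm u. Proof. exact: sqrtr_ge0. Qed.

Lemma sqr_nrm u : nrm u ^+ 2 = dot u u. Proof. by rewrite sqr_sqrtr. Qed.

Lemma cauchy_schwarz u v : dot u v ^+ 2 <= dot u u * dot v v.
Proof.
apply: discriminant_le0 => t.
have := dot_ge0 (t *: v + u).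
by rewrite dotl !dotDr !dotZr (dotC v u); move/le_trans; apply;
  rewrite le_eqVlt; apply/orP; left; apply/eqP; ring.
Qed.

Lemma norm_dot_le u v : `|dot u v| <= nrm u * nrm v.
Proof.
rewrite -(@ler_pXn2r _ 2) ?nnegrE ?mulr_ge0 ?nrm_ge0 //.
by rewrite real_normK ?num_real // exprMn !sqr_nrm cauchy_schwarz.
Qed.

Lemma nrmD u v : nrm (u + v) <= nrm u + nrm v.
Proof.
rewrite -(@ler_pXn2r _ 2) ?nnegrE ?addr_ge0 ?nrm_ge0 //.
rewrite sqr_nrm dotDl !dotDr (dotC v u) sqrrD !sqr_nrm.
have : dot u v <= nrm u * nrm v by rewrite (le_trans (ler_norm _)) ?norm_dot_le.
lra.
Qed.

Lemma nrmZ k u : nrm (k *: u) = `|k| * nrm u.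
Proof. by rewrite /nrm dotZl dotZr mulrA -expr2 sqrtrM ?sqr_ge0 // sqrtr_sqr. Qed.

Lemma nrmN u : nrm (- u) = nrm u.
Proof. by rewrite -scaleN1r nrmZ normrN1 mul1r. Qed.

Lemma nrmB u v : nrm (u - v) = nrm (v - u).
Proof. by rewrite -nrmN opprB. Qed.

Lemma nrm_le_sub u v : nrm u <= nrm v + nrm (u - v).
Proof. by apply: le_trans (nrmD _ _); rewrite addrC subrK. Qed.

(* If [e] has norm zero then the division gives 0 and [u] is left unchanged. *)
Fixpoint orthproj (s : seq H) (u : H) : H :=
  if s is v :: s' then
    let e := orthproj s' v in
    orthproj s' u - (dot (orthproj s' u) e / dot e e) *: e
  else u.

Definition orth (s : seq H) u := forall v, v \in s -> dot u v = 0.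

Lemma orth_cons v s u : orth (v :: s) u <-> dot u v = 0 /\ orth s u.
Proof.
split=> [h|[h1 h2] w]; first by split=> [|w ws]; apply: h; rewrite inE ?eqxx // ws orbT.
by rewrite inE => /predU1P[->|/h2].
Qed.

Lemma orth_comb s k u v : orth s u -> orth s v -> orth s (k *: u + v).
Proof. by move=> hu hv w ws; rewrite dotl hu // hv // mulr0 addr0. Qed.

(** The claims are proved together because the induction step uses them for the shorter list, in
    order to test with [e] in place of the new vector [v]. *)
Lemma projP s : [/\ forall k u v,
    orthproj s (k *: u + v) = k *: orthproj s u + orthproj s v,
  forall u, orth s (orthproj s u) &
  forall u w, orth s w -> dot (orthproj s u) w = dot u w].
Proof.
elim: s => [|v s [lin orth1 dot1]] /=; first by split.
set e := orthproj s v.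
have eW w : orth s w -> dot e w = dot v w by exact: dot1.
split.
- move=> k u w; rewrite lin dotl mulrDl scalerDl -mulrA -scalerA scalerBr opprD.
  by rewrite addrACA.
- move=> u; apply/orth_cons; split; last first.
    by rewrite addrC -scaleNr; apply: orth_comb; exact: orth1.
  have pe w : dot (orthproj s w) v = dot (orthproj s w) e.
    by rewrite dotC -eW // dotC.
  rewrite dotBl dotZl pe (_ : dot e v = dot e e); last exact: pe.
  (* A vector [e] of norm zero need not be the zero vector, but by Cauchy-Schwarz it is orthogonal
     to everything. *)
  have [e0|e0] := eqVneq (dot e e) 0; last by rewrite divfK // subrr.
  rewrite e0 mulr0 subr0; apply/eqP; rewrite -sqrf_eq0 eq_le sqr_ge0 andbT.
  by rewrite (le_trans (cauchy_schwarz _ _)) // e0 mulr0.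
- move=> u w /orth_cons[wv ws].
  by rewrite dotBl dotZl (dot1 u w ws) (eW w ws) (dotC v w) wv mulr0 subr0.
Qed.

Lemma proj_linear s k u v : orthproj s (k *: u + v) = k *: orthproj s u + orthproj s v.
Proof. by have [h _ _] := projP s. Qed.

Lemma proj_orth s u : orth s (orthproj s u).
Proof. by have [_ h _] := projP s; exact: h. Qed.

Lemma dot_proj s u w : orth s w -> dot (orthproj s u) w = dot u w.
Proof. by have [_ _ h] := projP s; exact: h. Qed.

Lemma projD s u v : orthproj s (u + v) = orthproj s u + orthproj s v.
Proof. by have := proj_linear s 1 u v; rewrite !scale1r. Qed.

Lemma projB s u v : orthproj s (u - v) = orthproj s u - orthproj s v.
Proof. by rewrite addrC -scaleN1r proj_linear scaleN1r addrC. Qed.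

Lemma proj_id s u : orth s u -> orthproj s u = u.
Proof.
elim: s => //= v s ih /orth_cons[uv us]; rewrite ih //.
by rewrite dotC dot_proj // dotC uv mul0r scale0r subr0.
Qed.

Lemma nrm_proj s u : nrm (orthproj s u) <= nrm u.
Proof.
have h : nrm (orthproj s u) ^+ 2 <= nrm u * nrm (orthproj s u).
  rewrite sqr_nrm dot_proj; last exact: proj_orth.
  by rewrite (le_trans (ler_norm _)) // norm_dot_le.
have := nrm_ge0 (orthproj s u); rewrite le_eqVlt => /predU1P[<-|p0]; first exact: nrm_ge0.
by rewrite expr2 ler_pM2r in h.
Qed.

(** These coefficients become the Lagrange multipliers in [reig_minimum]. *)
Lemma proj_span s u : exists c : nat -> R,
  u = orthproj s u + \sum_(i < size s) c i *: nth 0 s i.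
Proof.
elim: s u => [|v s ih] u /=; first by exists (fun=> 0); rewrite big_ord0 addr0.
have [c uE] := ih u; have [d vE] := ih v.
set e := orthproj s v; set k := dot _ e / _.
exists (fun i => if i is j.+1 then c j - k * d j else k).
rewrite big_ord_recl /=.
have -> : \sum_(i < size s) (c i - k * d i) *: nth 0 s i =
   (u - orthproj s u) - k *: (v - e).
  have Su : u - orthproj s u = \sum_(i < size s) c i *: nth 0 s i.
    by apply/eqP; rewrite subr_eq addrC -uE.
  have Sv : v - e = \sum_(i < size s) d i *: nth 0 s i.
    by apply/eqP; rewrite subr_eq addrC -vE.
  rewrite Su Sv scaler_sumr -sumrB; apply: eq_bigr => i _.
  by rewrite scalerBl scalerA.
rewrite scalerBr opprB (addrCA (k *: v)) (addrCA (k *: v)) subrr addr0.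
by rewrite addrACA addNr addr0 addrC subrK.
Qed.

(** * Minimisers of a compactly perturbed form under linear constraints *)

Section ConstrainedMinimum.
Variables (L V : {linear H -> H}) (KL KV : R) (s : seq H).
Hypothesis KL0 : 0 <= KL.
Hypothesis KV0 : 0 <= KV.
Hypothesis leL : forall u, nrm (L u) <= KL * nrm u.
Hypothesis leV : forall u, nrm (V u) <= KV * nrm u.
Hypothesis symV : forall u v, dot (V u) v = dot u (V v).
Hypothesis symL : forall h w, orth s h -> dot (L h) w = dot h (L w).
Hypothesis compactL : forall (u : nat -> H) C, (forall n, nrm (u n) <= C) ->
  exists y, forall e, 0 < e -> forall N, exists2 n, (N <= n)%N & nrm (L (u n) - y) <= e.

Definition energy h k := dot h k + dot (V (L h)) (L k).

Lemma energyl k u v w : energy (k *: u + v) w = k * energy u w + energy v w.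
Proof. by rewrite /energy !linearP !dotl; ring. Qed.

Lemma energyC u v : energy u v = energy v u.
Proof. by rewrite /energy dotC symV (dotC (L u)). Qed.

(** Coercivity: with [L h] normalised, the energy is bounded below and controls the norm of [h]. *)
Lemma energy_ge h : dot h h - KV * dot (L h) (L h) <= energy h h.
Proof.
rewrite /energy lerD2l lerNl.
rewrite (le_trans (ler_norm _)) // normrN (le_trans (norm_dot_le _ _)) //.
by rewrite -sqr_nrm expr2 mulrA ler_wpM2r ?nrm_ge0.
Qed.

(* For a minimising sequence [u_n], Cauchy-Schwarz for the nonnegative form
   [energy - m <L ., L .>] makes the projected residual of the Euler equation tend
   to 0; then [u_n] is, up to o(1), a continuous image of the relatively compact
   [L u_n]. *)
Lemma constrained_minimum h0 (M : R) : orth s h0 -> dot (L h0) (L h0) = 1 ->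
  energy h0 h0 <= M ->
  exists (m : R) (h : H), [/\ m <= M, orth s h, dot (L h) (L h) = 1 &
    forall k, orth s k -> energy h k = m * dot (L h) (L k)].
Proof.
move=> oh0 Nh0 Qh0.
pose A := [set energy h h | h in [set h | orth s h /\ dot (L h) (L h) = 1]].
have A0 : A (energy h0 h0) by exists h0.
have Alb : lbound A (- KV).
  move=> _ [h [oh Nh] <-]; apply: le_trans (energy_ge h).
  by rewrite Nh mulr1; have := dot_ge0 h; lra.
have hA : has_inf A by split; [exists (energy h0 h0)|exists (- KV)].
pose m := inf A.
pose Z u := V u - m *: u.
have ZB u v : Z (u - v) = Z u - Z v.
  by rewrite /Z linearB scalerBr !opprB addrACA [RHS]addrACA [- V v - _]addrC.
pose KZ := KV + `|m|.
have KZ0 : 0 <= KZ by rewrite addr_ge0.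
have leZ u : nrm (Z u) <= KZ * nrm u.
  by rewrite (le_trans (nrmD _ _)) // nrmN nrmZ mulrDl lerD2r leV.
pose q h k := dot h k + dot (Z (L h)) (L k).
have qE h k : q h k = energy h k - m * dot (L h) (L k).
  by rewrite /q /Z dotBl dotZl /energy addrA.
have ql k u v w : q (k *: u + v) w = k * q u w + q v w.
  by rewrite !qE energyl linearP dotl; ring.
have qC u v : q u v = q v u by rewrite !qE energyC (dotC (L u)).
have q_ge0 h : orth s h -> 0 <= q h h.
  move=> oh; rewrite qE subr_ge0.
  (* If [L h] has norm zero it cannot be normalised, and [energy_ge] gives the sign directly;
     otherwise rescaling reduces to the definition of [m]. *)
  have [N0|N0] := eqVneq (dot (L h) (L h)) 0.
    by rewrite N0 mulr0 (le_trans _ (energy_ge h)) // N0 mulr0 subr0.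
  have Np : 0 < dot (L h) (L h) by rewrite lt_neqAle eq_sym N0 dot_ge0.
  pose c := (nrm (L h))^-1.
  have cE : c ^+ 2 = (dot (L h) (L h))^-1 by rewrite exprVn sqr_nrm.
  have : A (energy (c *: h) (c *: h)).
    exists (c *: h) => //; split.
      by move=> v vs; rewrite dotZl oh // mulr0.
    by rewrite linearZ dotZl dotZr mulrA -expr2 cE mulVf.
  move=> /(ge_inf hA.2); rewrite -/m.
  have eZ k u v : energy (k *: u) v = k * energy u v.
    by rewrite /energy !linearZ !dotZl; ring.
  by rewrite eZ energyC eZ mulrA -expr2 cE mulrC ler_pdivlMr.
have minseq n : exists g, [/\ orth s g, dot (L g) (L g) = 1 & q g g <= n.+1%:R^-1].
  have n0 : 0 < n.+1%:R^-1 :> R by rewrite invr_gt0.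
  have [_ [g [og Ng] <-] lt] := inf_adherent n0 hA.
  by exists g; split => //; rewrite qE Ng mulr1 lerBlDl ltW.
have [g gP] := choice minseq.
have gO n : orth s (g n) by have [] := gP n.
have gN n : dot (L (g n)) (L (g n)) = 1 by have [] := gP n.
have gq n : q (g n) (g n) <= n.+1%:R^-1 by have [] := gP n.
(* By [energy_ge] the squared norm of [g n] is at most [|m| + 1 + KV <= B], and [B <= B ^+ 2]
   because [B >= 1]. *)
pose B := 1 + `|m| + KV + 1.
have B1 : 1 <= B by rewrite /B; move: (normr_ge0 m) KV0; move: `|m| => *; lra.
have gB n : nrm (g n) <= B.
  rewrite -(@ler_pXn2r _ 2) ?nnegrE ?nrm_ge0 ?(le_trans ler01) // sqr_nrm.
  have := energy_ge (g n); rewrite gN mulr1.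
  have := gq n; rewrite qE gN mulr1 => h1 h2.
  have h3 : n.+1%:R^-1 <= 1 :> R by rewrite invf_le1 ?ltr0n // ler1n.
  have h4 := ler_norm m.
  have h5 : B <= B ^+ 2 by rewrite expr2 ler_peMl // (le_trans ler01).
  apply: le_trans h5; rewrite /B; move: h1 h2 h3 h4.
  by move: (n.+1%:R^-1) (energy (g n) (g n)) (dot (g n) (g n)) `|m| => *; lra.
have [y yP] := compactL gB.
pose P := orthproj s.
(* The Euler equation reads [h = - P (L (Z (L h)))] up to a null vector. Putting the limit [y] of
   the [L (g n)] in place of [L h] defines [h] outright; that [L h] agrees with [y] is checked
   afterwards. *)
pose h := - P (L (Z y)).
pose r n := P (g n + L (Z (L (g n)))).
have rO n : orth s (r n) by exact: proj_orth.
pose K1 := (1 + KL * (KZ * KL)) * B.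
have K10 : 0 <= K1.
  by apply: mulr_ge0; [rewrite addr_ge0 // !mulr_ge0|exact: le_trans ler01 B1].
have LZL u : nrm (L (Z (L u))) <= KL * (KZ * KL) * nrm u.
  rewrite (le_trans (leL _)) // -mulrA ler_wpM2l // (le_trans (leZ _)) //.
  by rewrite -mulrA ler_wpM2l // leL.
have rB n : nrm (r n) <= K1.
  rewrite (le_trans (nrm_proj _ _)) // (le_trans (nrmD _ _)) //.
  rewrite /K1 mulrDl mul1r lerD // (le_trans (LZL _)) //.
  by rewrite ler_wpM2l // !mulr_ge0.
pose K2 := K1 ^+ 2 + KZ * KL ^+ 2 * K1 ^+ 2.
have K20 : 0 <= K2.
  apply: addr_ge0; first exact: exprn_ge0.
  by apply: mulr_ge0; [apply: mulr_ge0 => //|]; exact: exprn_ge0.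
have qr n : q (r n) (r n) <= K2.
  apply: lerD; first by rewrite -sqr_nrm ler_pXn2r ?nnegrE ?nrm_ge0.
  rewrite (le_trans (ler_norm _)) // (le_trans (norm_dot_le _ _)) //.
  apply: (@le_trans _ _ (KZ * nrm (L (r n)) * nrm (L (r n)))).
    by rewrite ler_wpM2r ?nrm_ge0.
  rewrite -mulrA -expr2 -[leRHS]mulrA ler_wpM2l // -exprMn.
  rewrite ler_pXn2r ?nnegrE ?nrm_ge0 //; last exact: mulr_ge0.
  by rewrite (le_trans (leL _)) // ler_wpM2l.
have rrE n : dot (r n) (r n) = q (g n) (r n).
  by rewrite {1}/r dot_proj // dotDl (dotC (L _)) -symL // (dotC (L _)).
have r4 n : nrm (r n) ^+ 4 <= n.+1%:R^-1 * K2.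
  rewrite (_ : _ ^+ 4 = dot (r n) (r n) ^+ 2); last by rewrite -sqr_nrm -exprM.
  rewrite rrE; apply: (@le_trans _ _ (q (g n) (g n) * q (r n) (r n))); last first.
    by rewrite ler_pM // ?q_ge0.
  apply: discriminant_le0 => t.
  have := q_ge0 _ (orth_comb t (rO n) (gO n)).
  by rewrite ql !(qC _ (t *: _ + _)) !ql (qC (r n) (g n));
    move/le_trans; apply; rewrite le_eqVlt; apply/orP; left; apply/eqP; ring.
have close e : 0 < e -> exists g0, [/\ orth s g0, dot (L g0) (L g0) = 1,
    nrm (g0 - h) <= e & nrm (L g0 - y) <= e].
  (* [g0 - h] differs from the residual by the image of [L g0 - y] under a map of norm at most
     [KL * KZ]; when the residual and [L g0 - y] are within [e1], the total is at most [e / 2]. *)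
  move=> e0; pose e1 := e / (1 + KL * KZ) / 2.
  have d0 : 0 < 1 + KL * KZ by rewrite ltr_pwDl // mulr_ge0.
  have e10 : 0 < e1 by apply: divr_gt0 => //; apply: divr_gt0.
  have e1d : (1 + KL * KZ) * e1 = e / 2 by rewrite /e1; field; rewrite gt_eqF.
  have e1e : e1 <= e.
    have : 0 <= KL * KZ * e1 by apply: mulr_ge0; [exact: mulr_ge0|exact: ltW].
    move: e1d; rewrite mulrDl mul1r; move: (KL * KZ * e1) => z; lra.
  pose N := Num.truncn (K2 / e1 ^+ 4).
  have [n Nn yn] := yP _ e10 N.
  have re : nrm (r n) <= e1.
    rewrite -(@ler_pXn2r _ 4) ?nnegrE ?nrm_ge0 ?(ltW e10) // (le_trans (r4 n)) //.
    rewrite ler_pdivrMl ?ltr0n // mulrC -ler_pdivrMl ?exprn_gt0 // mulrC.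
    by rewrite (le_trans (ltW (truncnS_gt _))) // ler_nat.
  exists (g n); split => //; last exact: le_trans e1e.
  have -> : g n - h = r n - P (L (Z (L (g n) - y))).
    have -> : P (L (Z (L (g n) - y))) = P (L (Z (L (g n)))) - P (L (Z y)).
      by rewrite ZB (linearB L (Z _) (Z _)) /P (projB s (L (Z _)) (L (Z _))).
    rewrite /r /h [P (g n + _)]projD (proj_id (gO n)) -/P.
    by rewrite (opprK (P _)) (opprB (P _) (P _)) addrACA (subrr (P _)) addr0.
  rewrite (le_trans (nrmD _ _)) // nrmN.
  have : nrm (P (L (Z (L (g n) - y)))) <= KL * KZ * e1.
    rewrite (le_trans (nrm_proj _ _)) // (le_trans (leL _)) // -mulrA ler_wpM2l //.
    by rewrite (le_trans (leZ _)) // ler_wpM2l.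
  lra.
have small x : 0 <= x -> (forall e, 0 < e -> x <= (KL + 1) * e) -> x = 0.
  move=> x0 hx; apply/eqP; rewrite eq_le x0 andbT leNgt; apply/negP => xp.
  have K0 : 0 < KL + 1 by rewrite ltr_wpDl.
  have := hx (x / (KL + 1) / 2); rewrite !divr_gt0 // => /(_ isT).
  have -> : (KL + 1) * (x / (KL + 1) / 2) = x / 2 by field; rewrite gt_eqF.
  lra.
(* Both vectors are compared with a near-minimiser [g0]: [L g0 - y] costs [e] and [L (g0 - h)] costs
   [KL * e]. *)
have Ly : nrm (L h - y) = 0.
  apply: small => [|e e0]; first exact: nrm_ge0.
  have [g0 [_ _ gh gy]] := close e e0.
  have -> : L h - y = (L g0 - y) - L (g0 - h).
    by rewrite (linearB L g0 h) (opprB (L g0)) [RHS]addrC addrA subrK.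
  rewrite (le_trans (nrmD _ _)) // nrmN mulrDl mul1r addrC lerD //.
  by rewrite (le_trans (leL _)) // ler_wpM2l.
have NLh : nrm (L h) = 1.
  apply/eqP; rewrite -subr_eq0 -normr_eq0; apply/eqP.
  apply: small => // e e0; have [g0 [_ Ng gh _]] := close e e0.
  have ng : nrm (L g0) = 1 by rewrite /nrm Ng sqrtr1.
  have := nrm_le_sub (L h) (L g0); have := nrm_le_sub (L g0) (L h).
  rewrite (nrmB (L h)) -(linearB L g0 h) ng => h1 h2.
  have h3 : nrm (L (g0 - h)) <= (KL + 1) * e.
    rewrite (le_trans (leL _)) // (le_trans (ler_wpM2l KL0 gh)) //.
    by apply: ler_wpM2r; [exact: ltW|rewrite lerDl].
  rewrite ler_norml; apply/andP; split; last by rewrite lerBlDl (le_trans h2) // lerD2l.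
  by rewrite lerNl opprB lerBlDl (le_trans h1) // lerD2l.
have oh : orth s h by move=> v vs; rewrite dotNl proj_orth // oppr0.
exists m, h; split => //.
- by rewrite (le_trans _ Qh0) // ge_inf //; exact: hA.2.
- by rewrite -sqr_nrm NLh expr1n.
(* By the choice of [h], the shifted form at [h] and [k] is the product of [Z (L h - y)], a vector
   of norm zero, with [L k]. *)
move=> k ok; apply/eqP; rewrite -subr_eq0 -qE /q {1}/h dotNl dot_proj //.
rewrite (dotC (L _)) -symL // (dotC (L k)) addrC -dotBl -ZB.
rewrite -normr_eq0 eq_le normr_ge0 andbT (le_trans (norm_dot_le _ _)) //.
have := leZ (L h - y); rewrite Ly mulr0 => z0.
by rewrite mulr_le0_ge0 ?nrm_ge0.
Qed.

End ConstrainedMinimum.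
End PreHilbert.

(** * Continuous functions on an interval *)

Section ContinuousFunctions.
Context {R : realType}.

Definition contf : {pred R -> R} := fun f => `[< continuous f >].

Lemma contf_submod : submod_closed contf.
Proof.
split; first by apply/asboolP; exact: cst_continuous.
move=> k u v /asboolP cu /asboolP cv; apply/asboolP => x.
by apply: cvgD; [apply: cvgM; [exact: cvg_cst|exact: cu]|exact: cv].
Qed.

HB.instance Definition _ := GRing.isSubmodClosed.Build R (R -> R) contf contf_submod.

(** Functions on the whole line form a module without a quotient; the price is that [cdot], which
    sees only [[a, b]], is semidefinite. *)
Record cfun := CFun { cfun_val :> R -> R; cfunP : cfun_val \in contf }.

HB.instance Definition _ := [isSub for cfun_val].
HB.instance Definition _ := [Choice of cfun by <:].
HB.instance Definition _ := [SubChoice_isSubLmodule of cfun by <:].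

Lemma cfun_continuous (u : cfun) : continuous u.
Proof. by apply/asboolP; exact: (cfunP u). Qed.

Definition mkcfun (f : R -> R) (cf : continuous f) : cfun :=
  CFun (introT (asboolP _) cf).

Lemma cfunDE (u v : cfun) x : (u + v) x = u x + v x. Proof. by []. Qed.
Lemma cfunZE k (u : cfun) x : (k *: u) x = k * u x. Proof. by []. Qed.
Lemma cfun0E x : (0 : cfun) x = 0. Proof. by []. Qed.
Lemma cfunNE (u : cfun) x : (- u) x = - u x. Proof. by []. Qed.
Definition cfunE := (cfunDE, cfunZE, cfun0E, cfunNE).

Lemma cfun_sumE (I : Type) (s : seq I) (F : I -> cfun) x :
  (\sum_(i <- s) F i) x = \sum_(i <- s) F i x.
Proof. by elim/big_rec2: _ => // i y1 y2 _ <-. Qed.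

Lemma cfun_eqP (u v : cfun) : u =1 v -> u = v.
Proof. by move=> uv; apply: val_inj; apply/funext. Qed.

Definition ccst k : cfun := mkcfun (@cst_continuous R R k).

End ContinuousFunctions.
Arguments cfun : clear implicits.

(* Sealing these operations keeps unification from unfolding integrals. *)
HB.lock Definition cmul {R : realType} (u v : cfun R) : cfun R :=
  @mkcfun R (fun x => u x * v x)
    (fun x => cvgM (@cfun_continuous R u x) (@cfun_continuous R v x)).

Lemma cmulE {R : realType} (u v : cfun R) x : cmul u v x = u x * v x.
Proof. by rewrite cmul.unlock. Qed.

Lemma cmul_is_linear {R : realType} (u : cfun R) : linear (cmul u).
Proof.
by move=> k v w; apply: cfun_eqP => x; rewrite !(cfunE, cmulE) mulrDr mulrCA.
Qed.

HB.instance Definition _ {R : realType} (u : cfun R) :=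
  GRing.isLinear.Build R (cfun R) (cfun R) *:%R (cmul u) (cmul_is_linear u).

HB.lock Definition cint {R : realType} (a b : R) (u : cfun R) : R :=
  \int[@lebesgue_measure R]_(x in `[a, b]) u x.

Section Integral.
Context {R : realType}.
Notation mu := (@lebesgue_measure R).
Implicit Types (u v w : cfun R) (a b c d x y : R).

Lemma cintE a b u : cint a b u = \int[mu]_(x in `[a, b]) u x.
Proof. by rewrite cint.unlock. Qed.

Lemma cfun_integrable a b u : mu.-integrable `[a, b] (EFin \o u).
Proof.
apply: continuous_compact_integrable; first exact: segment_compact.
by apply: continuous_subspaceT; exact: cfun_continuous.
Qed.

Lemma cint_linear a b : linear_for *%R (cint a b).
Proof.
move=> k u v; rewrite !cintE.
transitivity (\int[mu]_(x in `[a, b]) ((k *: u) x + v x)); first by [].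
rewrite RintegralD //; try exact: cfun_integrable.
by congr (_ + _); rewrite -RintegralZl //; exact: cfun_integrable.
Qed.

HB.instance Definition _ a b :=
  GRing.isLinear.Build R (cfun R) R *%R (cint a b) (cint_linear a b).

Lemma eq_cint a b u v : (forall x, a <= x <= b -> u x = v x) ->
  cint a b u = cint a b v.
Proof.
move=> uv; rewrite !cintE; apply: eq_Rintegral => x.
by rewrite inE /= in_itv /=; exact: uv.
Qed.

Lemma le_cint a b u v : (forall x, a <= x <= b -> u x <= v x) ->
  cint a b u <= cint a b v.
Proof.
by move=> uv; rewrite !cintE; apply: le_Rintegral => //; exact: cfun_integrable.
Qed.

Lemma cint_ge0 a b u : (forall x, a <= x <= b -> 0 <= u x) -> 0 <= cint a b u.
Proof. by move=> u0; rewrite -(linear0 (cint a b)); exact: le_cint. Qed.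

Lemma cint_point a u : cint a a u = 0.
Proof. by rewrite cintE set_itv1 Rintegral_set1. Qed.

Lemma cint_split c a b u : a <= c <= b -> cint a b u = cint a c u + cint c b u.
Proof.
move=> /andP[ac cb]; apply/eqP; rewrite addrC -subr_eq; apply/eqP.
rewrite !cintE Rintegral_itvB ?bnd_simp //; last exact: cfun_integrable.
rewrite Rintegral_itv_obnd_cbnd //.
by apply: integrableS (cfun_integrable c b u) => //; apply: subset_itvr; rewrite bnd_simp.
Qed.

Lemma cint_cst a b k : a <= b -> cint a b (ccst k) = k * (b - a).
Proof.
move=> ab; rewrite cintE /= Rintegral_cst //= lebesgue_measure_itv /= lte_fin.
by rewrite lt_neqAle ab andbT; case: eqVneq => //= ->; rewrite subrr.
Qed.

(** The pieces outside [[c, d]] contribute at most 0. The gain is the factor [d - c] instead of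
    [b - a]; in [eig_lower] it is the width of an interval containing the singular support. *)
Lemma cint_bump a b c d (k : R) u : a <= c -> c <= d -> d <= b ->
  (forall x, c <= x <= d -> u x <= k) ->
  (forall x, a <= x <= b -> ~~ (c < x < d) -> u x <= 0) ->
  cint a b u <= k * (d - c).
Proof.
move=> ac cd db uk u0.
have neg x y : a <= x -> y <= b -> (forall z, x <= z <= y -> ~~ (c < z < d)) ->
    cint x y u <= 0.
  move=> ax yb h; rewrite -(linear0 (cint x y)); apply: le_cint => z xzy.
  apply: u0; last exact: h.
  by case/andP: xzy => xz zy; rewrite (le_trans ax) // (le_trans zy).
rewrite (@cint_split c) ?ac ?(le_trans cd) // (@cint_split d c) ?cd //.
have h1 : cint a c u <= 0.
  by apply: neg => //; [rewrite (le_trans cd)|move=> z /andP[_ zc]; rewrite ltNge zc].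
have h2 : cint d b u <= 0.
  by apply: neg => //; [rewrite (le_trans ac)|move=> z /andP[dz _]; rewrite andbC ltNge dz].
have h3 : cint c d u <= k * (d - c).
  by rewrite -cint_cst //; apply: le_cint => x; exact: uk.
lra.
Qed.

Definition clamp a b x : R := Num.max a (Num.min b x).

Lemma clamp_itv a b x : a <= b -> a <= clamp a b x <= b.
Proof. by move=> ab; rewrite /clamp le_max lexx /= ge_max ab ge_min lexx. Qed.

Lemma clamp_id a b x : a <= x <= b -> clamp a b x = x.
Proof. by move=> /andP[ax xb]; rewrite /clamp (min_idPr xb) (max_idPr ax). Qed.

Lemma clamp_lip a b x y : `|clamp a b x - clamp a b y| <= `|x - y|.
Proof.
wlog xy : x y / x <= y.
  move=> h; have [/h//|/ltW yx] := leP x y.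
  by rewrite distrC (distrC x); exact: h.
rewrite /clamp /Num.max /Num.min.
rewrite (distrC x) (ger0_norm (_ : 0 <= y - x)) ?subr_ge0 // ler_norml.
by case: (ltP b x) => ?; case: (ltP b y) => ?; case: ltP => ?; case: ltP => ?;
  apply/andP; split; lra.
Qed.

Lemma clamp_continuous a b : continuous (clamp a b).
Proof.
move=> x; apply/cvgrPdist_le => e e0; near=> y.
by rewrite (le_trans (clamp_lip _ _ _ _)).
Unshelve. all: by end_near.
Qed.

Lemma within_clamp_continuous a b (f : R -> R) : a <= b ->
  {within `[a, b], continuous f} -> continuous (f \o clamp a b).
Proof.
move=> ab cf x.
have cab y : `[a, b]%classic (clamp a b y) by rewrite /= in_itv /= clamp_itv.
have /subspace_continuousP /(_ _ (cab x)) h := cf.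
move=> S /h /=; rewrite /within /= !nbhs_simpl /= => hS.
have := @clamp_continuous a b x _ hS.
rewrite /= !nbhs_simpl /=.
by apply: filterS => y; apply; exact: cab.
Qed.

End Integral.

Lemma prim_continuous {R : realType} (a b : R) (ab : a < b) (u : cfun R) :
  continuous (fun x => cint a (clamp a b x) u).
Proof.
apply: (@within_clamp_continuous _ a b (fun x => cint a x u)); first exact: ltW.
rewrite (_ : (cint a)^~ u = fun x => \int[@lebesgue_measure R]_(t in `[a, x]) u t).
  apply: (parameterized_integral_continuous (ltW ab)); exact: cfun_integrable.
by apply/funext => x; rewrite cintE.
Qed.

(* Integration from [a], frozen outside [a, b] so as to be continuous on the line. *)
HB.lock Definition prim {R : realType} (a b : R) (ab : a < b) (u : cfun R) : cfun R :=
  mkcfun (@prim_continuous R a b ab u).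

Arguments prim {R a b} ab u.

HB.lock Definition cdot {R : realType} (a b : R) (u v : cfun R) : R :=
  cint a b (cmul u v).

Section Primitive.
Context {R : realType}.
Notation mu := (@lebesgue_measure R).
Variables (a b : R).
Hypothesis ab : a < b.
Implicit Types (u v w h : cfun R) (c d x y : R).

Let leab : a <= b := ltW ab.
Notation prim := (prim ab).
Notation cdot := (cdot a b).

Lemma prim_clampE u x : prim u x = cint a (clamp a b x) u.
Proof. by rewrite prim.unlock. Qed.

Lemma cdotE u v : cdot u v = cint a b (cmul u v).
Proof. by rewrite cdot.unlock. Qed.

Lemma primE u x : a <= x <= b -> prim u x = cint a x u.
Proof. by move=> xab; rewrite prim_clampE clamp_id. Qed.

Lemma prim_a u : prim u a = 0.
Proof. by rewrite primE ?lexx ?leab // cint_point. Qed.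

Lemma prim_b u : prim u b = cint a b u.
Proof. by rewrite primE // lexx leab. Qed.

Lemma prim_is_linear : linear prim.
Proof. by move=> k u v; apply: cfun_eqP => x; rewrite !(cfunE, prim_clampE) linearP. Qed.

HB.instance Definition _ :=
  GRing.isLinear.Build R (cfun R) (cfun R) *:%R prim prim_is_linear.

Lemma eq_prim u v : (forall x, a <= x <= b -> u x = v x) -> prim u =1 prim v.
Proof.
move=> uv x; rewrite !prim_clampE; apply: eq_cint => t /andP[at_ tx].
apply: uv; rewrite at_ (le_trans tx) //.
by have /andP[] := clamp_itv x leab.
Qed.

Lemma prim_clamp u x : prim u (clamp a b x) = prim u x.
Proof. by rewrite !prim_clampE [clamp a b (clamp _ _ _)]clamp_id // clamp_itv. Qed.

Lemma prim_deriv u x : a < x < b ->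
  derivable (prim u) x 1 /\ derive1 (prim u) x = u x.
Proof.
move=> /andP[ax xb].
have nE : {near x, prim u =1 (fun x => \int[mu]_(t in `[a, x]) u t)}.
  have : x \in `]a, b[ by rewrite in_itv /= ax.
  move=> /near_in_itvoo; apply: filterS => y; rewrite in_itv /= => /andP[ay yb].
  by rewrite primE ?cintE // !ltW.
have [] := @continuous_FTC1_closed _ u a x b xb (cfun_integrable a b u) ax
  (@cfun_continuous _ u x).
move=> d1 d2; split.
  by apply: near_eq_derivable d1; apply: filterS nE => y ->.
rewrite derive1E -d2 derive1E; exact: near_eq_derive.
Qed.

Lemma prim_LR u : derivable_oo_LRcontinuous (prim u) a b.
Proof.
split.
- by move=> x; rewrite in_itv /= => xab; have [] := prim_deriv u xab.
- by apply: cvg_at_right_filter; exact: (@cfun_continuous _ (prim u) a).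
- by apply: cvg_at_left_filter; exact: (@cfun_continuous _ (prim u) b).
Qed.

(** Both primitives vanish at [a], so the only boundary term is the one at [b]. *)
Lemma cdot_parts u v : cdot (prim u) v = prim u b * prim v b - cdot u (prim v).
Proof.
have cw w : {within `[a, b], continuous w}.
  by apply: continuous_subspaceT; exact: cfun_continuous.
have dw w : {in `]a, b[, derive1 (prim w) =1 w}.
  by move=> x; rewrite in_itv /= => xab; have [] := prim_deriv w xab.
have := Rintegration_by_parts ab (cw u) (prim_LR u) (dw u) (cw v) (prim_LR v) (dw v).
rewrite !prim_a mul0r subr0 !cdotE !cintE => E.
transitivity (\int[mu]_(x in `[a, b]) (prim u x * v x)).
  by apply: eq_Rintegral => x _; rewrite cmulE.
by rewrite E; congr (_ - _); apply: eq_Rintegral => x _; rewrite cmulE.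
Qed.

Lemma cdotC u v : cdot u v = cdot v u.
Proof. by rewrite !cdotE; apply: eq_cint => x _; rewrite !cmulE mulrC. Qed.

Lemma cdotl k u v w : cdot (k *: u + v) w = k * cdot u w + cdot v w.
Proof.
rewrite !cdotE -linearP; apply: eq_cint => x _.
by rewrite !(cmulE, cfunE) mulrDl mulrA.
Qed.

Lemma cdot_ge0 u : 0 <= cdot u u.
Proof. by rewrite cdotE; apply: cint_ge0 => x _; rewrite cmulE -expr2 sqr_ge0. Qed.

Lemma cdot1 u : cdot u (ccst 1) = cint a b u.
Proof. by rewrite cdotE; apply: eq_cint => x _; rewrite cmulE mulr1. Qed.

Lemma eq_cdot u v w h : (forall x, a <= x <= b -> u x = w x) ->
  (forall x, a <= x <= b -> v x = h x) -> cdot u v = cdot w h.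
Proof. by move=> uw vh; rewrite !cdotE; apply: eq_cint => x xab; rewrite !cmulE uw // vh. Qed.

Lemma cdot_cmul u v w : cdot (cmul u v) w = cdot v (cmul u w).
Proof. by rewrite !cdotE; apply: eq_cint => x _; rewrite !cmulE mulrCA mulrA. Qed.

Lemma FTC2_prim (F : R -> R) u : (forall x, is_derive x (1 : R) F (u x)) ->
  forall x, a <= x <= b -> prim u x = F x - F a.
Proof.
move=> dF x /[dup] xab /andP[]; rewrite le_eqVlt => /predU1P[<- _|ax xb].
  by rewrite prim_a subrr.
have cF : continuous F.
  by move=> y; apply/differentiable_continuous/derivable1_diffP; exact: ex_derive.
rewrite primE // cintE /Rintegral (@continuous_FTC2 _ u F a x ax) //.
- by apply: continuous_subspaceT; exact: cfun_continuous.
- split; [by move=> y _; exact: ex_derive| |].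
  by apply: cvg_at_right_filter; exact: (cF a).
  by apply: cvg_at_left_filter; exact: (cF x).
- by move=> y _; rewrite derive1E derive_val.
Qed.

End Primitive.
(** * Compactness of the double primitive *)

(** One ultrafilter on the indices gives limits at all points of [[a, b]] simultaneously, in place
    of a diagonal extraction. *)
Lemma ultra_fmap (T U : Type) (f : T -> U) (F : set_system T) :
  UltraFilter F -> UltraFilter (f @ F).
Proof.
move=> FU; split; first exact: fmap_proper_filter.
move=> G GF sfFG; rewrite predeqE => A; split; last exact: sfFG.
move=> GA; have [//|FnA] := in_ultra_setVsetC (f @^-1` A) FU.
have GnA : G (~` A) by exact: sfFG.
by have /filter_ex [? []] : G (A `&` ~` A) by exact: filterI.
Qed.

Section Bounds.
Context {R : realType}.
Implicit Types (u v w h : cfun R) (a b c d x y : R).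

Lemma cint_lower a b c d (k : R) u : a <= c -> c <= d -> d <= b ->
  (forall x, c <= x <= d -> k <= u x) ->
  (forall x, a <= x <= b -> 0 <= u x) -> k * (d - c) <= cint a b u.
Proof.
move=> ac cd db uk u0; rewrite -lerN2 -mulNr -linearN.
apply: cint_bump => // x xab; first by rewrite cfunE lerN2 uk.
by move=> _; rewrite cfunE oppr_le0 u0.
Qed.

(** If [u x] is nonzero, continuity keeps [|u|] above [|u x| / 2] on a subinterval of positive
    length. *)
Lemma cdot_eq0 a b u : a < b -> cdot a b u u = 0 -> forall x, a <= x <= b -> u x = 0.
Proof.
move=> ab u0 x /andP[ax xb]; apply/eqP; apply/negPn/negP => ux.
pose k := `|u x| / 2.
have k0 : 0 < k by rewrite divr_gt0 // normr_gt0.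
have /cvgrPdist_le /(_ _ k0) := @cfun_continuous _ u x.
move=> /nbhs_ballP[e /= e0 he].
pose c := Num.max a (x - e / 2); pose d := Num.min b (x + e / 2).
have e2 : 0 < e / 2 by rewrite divr_gt0.
have cd : c < d.
  by rewrite /c /d lt_min !gt_max; apply/andP; split; apply/andP; split; lra.
have : k ^+ 2 * (d - c) <= cdot a b u u.
  rewrite cdotE; apply: cint_lower; rewrite ?le_max ?ge_min ?lexx ?(ltW cd) //; last first.
    by move=> y _; rewrite cmulE -expr2 sqr_ge0.
  move=> y /andP[]; rewrite /c /d ge_max le_min => /andP[_ h1] /andP[_ h2].
  have : ball x e y by rewrite /ball /= ltr_norml; apply/andP; split; lra.
  move/he => /= h3.
  have h4 : k <= `|u y|.
    have := ler_dist_dist (u x) (u y); rewrite ler_norml => /andP[_ h5].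
    have : `|u x| = 2 * k by rewrite /k mulrC divfK.
    lra.
  by rewrite cmulE -expr2 -[leRHS]real_normK ?num_real // ler_pXn2r ?nnegrE // ltW.
rewrite u0 leNgt => /negP; apply.
by rewrite mulr_gt0 ?exprn_gt0 // subr_gt0.
Qed.

Variables (a b : R).
Hypothesis ab : a < b.
Let leab : a <= b := ltW ab.
Notation dot := (cdot a b).
Notation nr := (nrm (cdot a b)).
Notation J := (prim ab).

Lemma sqr_cnrm u : nr u ^+ 2 = dot u u.
Proof. by rewrite /nrm sqr_sqrtr ?cdot_ge0. Qed.

Lemma clamp_le x y : x <= y -> clamp a b x <= clamp a b y.
Proof.
move=> xy; rewrite /clamp ge_max !le_max lexx /= !le_min !ge_min lexx /= xy.
by rewrite orbT /= orbT.
Qed.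

(** Cauchy-Schwarz against the constant 1 on [[y, x]]. All real [x] and [y] are allowed because
    [prim] is frozen outside [[a, b]] and [clamp] does not increase distances. *)
Lemma prim_holder u x y : (J u x - J u y) ^+ 2 <= `|x - y| * dot u u.
Proof.
wlog yx : x y / y <= x.
  by move=> H; have [/H//|/ltW /H] := leP y x; rewrite -sqrrN opprB distrC.
rewrite -(prim_clamp ab u x) -(prim_clamp ab u y).
have /andP[ay yb] := clamp_itv y leab; have /andP[ax xb] := clamp_itv x leab.
have cyx := clamp_le yx.
apply: (@le_trans _ _ (`|clamp a b x - clamp a b y| * dot u u)); last first.
  by rewrite ler_wpM2r ?cdot_ge0 // clamp_lip.
move: (clamp a b x) (clamp a b y) ay yb ax xb cyx => {}x {}y ay yb ax xb {}yx.
rewrite !primE ?ax ?ay // (@cint_split _ y a x) ?ay // addrAC subrr add0r.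
rewrite ger0_norm ?subr_ge0 // -cdot1.
have := cauchy_schwarz (@cdotC _ y x) (@cdotl _ y x) (@cdot_ge0 _ y x) u (ccst 1).
move=> /le_trans; apply.
rewrite cdot1 cint_cst // mul1r mulrC ler_wpM2l ?subr_ge0 //.
rewrite !cdotE (@cint_split _ y a b) ?ay // (@cint_split _ x y b) ?yx //.
rewrite addrCA lerDl addr_ge0 // cint_ge0 // => z _; rewrite cmulE -expr2 sqr_ge0 //.
Qed.

Lemma prim_bound u x : J u x ^+ 2 <= (b - a) * dot u u.
Proof.
have := prim_holder u (clamp a b x) a; rewrite prim_clamp prim_a subr0.
move=> /le_trans; apply; rewrite ler_wpM2r ?cdot_ge0 //.
by have /andP[h1 h2] := clamp_itv x leab; rewrite ger0_norm ?subr_ge0 // lerD2r.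
Qed.

Lemma cdot_sup u (k : R) : (forall x, a <= x <= b -> u x ^+ 2 <= k) ->
  dot u u <= k * (b - a).
Proof.
by move=> uk; rewrite -cint_cst // cdotE; apply: le_cint => x xab; rewrite cmulE -expr2 uk.
Qed.

Lemma nrm_prim u : nr (J u) <= (b - a) * nr u.
Proof.
have ba : 0 <= b - a by rewrite subr_ge0.
rewrite -(@ler_pXn2r _ 2) ?nnegrE ?mulr_ge0 ?nrm_ge0 //.
rewrite exprMn !sqr_cnrm.
by rewrite expr2 -mulrA mulrC; apply: cdot_sup => x _; exact: prim_bound.
Qed.

Definition prim2 u := J (J u).

Lemma prim2_is_linear : linear prim2.
Proof. by move=> k u v; rewrite /prim2 !linearP. Qed.

HB.instance Definition _ :=
  GRing.isLinear.Build R (cfun R) (cfun R) *:%R prim2 prim2_is_linear.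

Lemma eq_prim2 u v : (forall x, a <= x <= b -> u x = v x) -> prim2 u =1 prim2 v.
Proof. by move=> uv; apply: eq_prim => x _; exact: eq_prim. Qed.

Lemma nrm_prim2 u : nr (prim2 u) <= (b - a) ^+ 2 * nr u.
Proof.
rewrite (le_trans (nrm_prim _)) // expr2 -mulrA ler_wpM2l ?subr_ge0 //.
exact: nrm_prim.
Qed.

Lemma cfun_bounded u : exists2 k : R, 0 <= k & forall x, a <= x <= b -> `|u x| <= k.
Proof.
have cn : {within `[a, b], continuous (fun x => `|u x|)}.
  apply: continuous_subspaceT => x; apply: cvg_norm; exact: cfun_continuous.
have [c _ hc] := EVT_max leab cn.
by exists `|u c| => // x xab; apply: hc; rewrite in_itv.
Qed.

Lemma nrm_cmul w (k : R) u : 0 <= k -> (forall x, a <= x <= b -> `|w x| <= k) ->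
  nr (cmul w u) <= k * nr u.
Proof.
move=> k0 wk.
rewrite -(@ler_pXn2r _ 2) ?nnegrE ?mulr_ge0 ?nrm_ge0 //.
rewrite exprMn !sqr_cnrm.
rewrite !cdotE -linearZ; apply: le_cint => x xab; rewrite cfunZE !cmulE -!expr2 exprMn.
rewrite ler_wpM2r ?sqr_ge0 // -[leLHS]real_normK ?num_real //.
by rewrite ler_pXn2r ?nnegrE // wk.
Qed.

(** Arzela-Ascoli: the functions [prim2 (u n)] are bounded and share a Holder modulus, their
    pointwise limit along an ultrafilter inherits it, and a finite grid turns pointwise closeness
    into uniform closeness. *)
Lemma compact_prim2 (u : nat -> cfun R) (C : R) : (forall n, nr (u n) <= C) ->
  exists y : cfun R, forall e, 0 < e -> forall N,
    exists2 n, (N <= n)%N & nr (prim2 (u n) - y) <= e.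
Proof.
move=> uC.
have [F [UF ooF]] := @ultraFilterLemma nat \oo _.
have C0 : 0 <= C by rewrite (le_trans _ (uC 0%N)) // nrm_ge0.
have JD n : dot (J (u n)) (J (u n)) <= ((b - a) * C) ^+ 2.
  rewrite -sqr_cnrm.
  rewrite ler_pXn2r ?nnegrE ?nrm_ge0 ?mulr_ge0 ?subr_ge0 //.
  by rewrite (le_trans (nrm_prim _)) // ler_wpM2l ?subr_ge0.
set D := ((b - a) * C) ^+ 2 in JD.
have D0 : 0 <= D by exact: sqr_ge0.
pose B := Num.sqrt ((b - a) * D).
have bnd n x : `|prim2 (u n) x| <= B.
  rewrite -sqrtr_sqr ler_sqrt ?mulr_ge0 ?subr_ge0 //.
  by rewrite (le_trans (prim_bound _ _)) // ler_wpM2l ?subr_ge0.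
have ex_lim x : exists l : R, prim2 (u n) x @[n --> F] --> l.
  have := @segment_compact R (- B) B; rewrite compact_ultra.
  move=> /(_ ((fun n => prim2 (u n) x) @ F)) [].
  - exact: ultra_fmap.
  - apply: (@filterS _ F _ setT); last exact: filterT.
    by move=> n _; rewrite /= in_itv /= -ler_norml; exact: (bnd n x).
  - by move=> l [_ hl]; exists l.
have [y yl] := choice ex_lim.
have FF : ProperFilter F by exact: ultra_proper.
have yh x z : (y x - y z) ^+ 2 <= `|x - z| * D.
  have cv : prim2 (u n) x - prim2 (u n) z @[n --> F] --> y x - y z by exact: cvgB.
  rewrite expr2; apply: (ler_cvg_to (cvgM cv cv) (cvg_cst _)); apply: nearW => n.
  apply: le_trans (ler_wpM2l (normr_ge0 (x - z)) (JD n)).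
  exact: (prim_holder (J (u n)) x z).
(* [D] may be 0, so the moduli below divide by [D + 1]. *)
have D1 : 0 < D + 1 by rewrite ltr_wpDl.
have mod_cont (f : R -> R) (hf : forall x z, (f x - f z) ^+ 2 <= `|x - z| * D) e x z :
    0 < e -> `|x - z| <= e ^+ 2 / (D + 1) -> `|f x - f z| <= e.
  move=> e0 xz; rewrite -(@ler_pXn2r _ 2) ?nnegrE ?(ltW e0) //.
  rewrite real_normK ?num_real // (le_trans (hf _ _)) //.
  rewrite (@le_trans _ _ (`|x - z| * (D + 1))) //.
    by rewrite ler_wpM2l // lerDl.
  by rewrite -ler_pdivlMr.
have cy : continuous y.
  move=> x; apply/cvgrPdist_le => e e0.
  have d0 : 0 < e ^+ 2 / (D + 1) by rewrite divr_gt0 ?exprn_gt0.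
  by near=> z; apply: mod_cont.
have ba0 : 0 < b - a by rewrite subr_gt0.
exists (mkcfun cy) => e e0 N.
pose s := Num.sqrt (b - a).
have s0 : 0 < s by rewrite sqrtr_gt0.
(* Two moves to a grid point and the convergence there cost [e1] each; the uniform error [3 * e1]
   becomes [3 * e1 * s = e] in norm. *)
pose e1 := e / (3 * s).
have e10 : 0 < e1 by rewrite divr_gt0 // mulr_gt0.
have e3 : 0 <= 3 * e1 by apply: mulr_ge0 => //; exact: ltW.
pose d := e1 ^+ 2 / (D + 1).
have d0 : 0 < d by rewrite divr_gt0 ?exprn_gt0.
pose N0 := (Num.truncn ((b - a) / d)).+1.
have nearF : \forall n \near F, forall i : 'I_N0,
    `|y (a + i%:R * d) - prim2 (u n) (a + i%:R * d)| <= e1.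
  by apply: filter_forall => i; move/cvgrPdist_le: (yl (a + i%:R * d)); apply.
have nearN : F [set n | (N <= n)%N] by apply: ooF; exact: nbhs_infty_ge.
have [n [/= hn Nn]] := filter_ex (filterI nearF nearN).
exists n => //.
rewrite -(@ler_pXn2r _ 2) ?nnegrE ?nrm_ge0 ?(ltW e0) // sqr_cnrm.
have -> : e ^+ 2 = (3 * e1) ^+ 2 * (b - a).
  have <- : s ^+ 2 = b - a by rewrite sqr_sqrtr // ltW.
  by rewrite /e1; field; rewrite gt_eqF.
apply: cdot_sup => x /andP[ax xb].
rewrite -[leLHS]real_normK ?num_real // ler_pXn2r ?nnegrE ?e3 //.
have q0 : 0 <= (x - a) / d by rewrite divr_ge0 ?subr_ge0 // ltW.
have iN : (Num.truncn ((x - a) / d) < N0)%N.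
  rewrite ltnS; apply: le_truncn; first by rewrite ler_pM2r ?invr_gt0 // lerD2r.
set i := Num.truncn _ in iN.
have xi : `|x - (a + i%:R * d)| <= d.
  have /andP[h1 h2] := truncn_itv q0; rewrite -/i in h1 h2.
  rewrite ler_pdivlMr // in h1; rewrite ltr_pdivrMr // -natr1 mulrDl mul1r in h2.
  by rewrite ler_norml; apply/andP; split; lra.
have m1 := mod_cont _ yh _ _ _ e10 xi.
have h2 := hn (Ordinal iN).
have m2 : `|prim2 (u n) x - prim2 (u n) (a + i%:R * d)| <= e1.
  apply: mod_cont => // z1 z2.
  by rewrite (le_trans (prim_holder _ _ _)) // ler_wpM2l.
rewrite !cfunE /=.
move: h2 m1 m2 => /=; rewrite !ler_norml => /andP[? ?] /andP[? ?] /andP[? ?].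
by apply/andP; split; lra.
Unshelve. all: by end_near.
Qed.

End Bounds.
(** * Real eigenfunctions *)

Section RealEigenfunctions.
Context {R : realType}.
Variables (a b : R).
Hypothesis ab : a < b.
Let leab : a <= b := ltW ab.
Implicit Types (u v w h k V : cfun R) (m x y p q c : R).
Notation dot := (cdot a b).
Notation J := (prim ab).
Notation L := (prim2 ab).

(* A function [f] vanishing with its derivative at both ends is encoded by
   [h = f''], so that [f = prim2 h]. *)
Definition clamped h := prim ab h b = 0 /\ prim2 ab h b = 0.

(** The equation [f'''' + V f = m f] for [f = L h], integrated twice from [a]; [p] and [q] are the
    values of [f''] and [f'''] at [a]. *)
Definition reig V m h := clamped h /\ exists p q, forall x, a <= x <= b ->
  h x = p + q * (x - a) + L (m *: L h - cmul V (L h)) x.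

Definition cenergy V h k := energy (cdot a b) (prim2 ab) (cmul V) h k.

Lemma cenergyE V h k : cenergy V h k = dot h k + dot (cmul V (L h)) (L k).
Proof. by []. Qed.

Lemma prim2P c u v : L (c *: u + v) = c *: L u + L v.
Proof. exact: linearP. Qed.

Lemma cmulP V c u v : cmul V (c *: u + v) = c *: cmul V u + cmul V v.
Proof. exact: linearP. Qed.

Lemma clamped_comb c h k : clamped h -> clamped k -> clamped (c *: h + k).
Proof.
by move=> [h1 h2] [k1 k2]; rewrite /clamped !linearP !cfunE h1 h2 k1 k2 mulr0 addr0.
Qed.

Lemma clamped0 : clamped 0.
Proof. by rewrite /clamped !linear0. Qed.

Lemma clamped_sum (I : Type) (s : seq I) (F : I -> cfun R) (c : I -> R) :
  (forall i, clamped (F i)) -> clamped (\sum_(i <- s) c i *: F i).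
Proof.
move=> hF; elim/big_rec: _ => [|i y _ cy]; first exact: clamped0.
exact: (clamped_comb (c i) (hF i) cy).
Qed.

(** Two integrations by parts; the boundary terms at [b] vanish because [h] is clamped. *)
Lemma prim2_sym h w : clamped h -> dot (L h) w = dot h (L w).
Proof.
move=> [h1 h2]; rewrite cdot_parts [X in X * _](_ : _ = 0) // mul0r sub0r.
by rewrite cdot_parts h1 mul0r sub0r opprK.
Qed.

Lemma prim_cst1 x : a <= x <= b -> J (ccst 1) x = x - a.
Proof. by move=> /[dup] xab /andP[ax _]; rewrite primE // cint_cst // mul1r. Qed.

(** The values at [b] of the two primitives are the integrals of [h] and of [(b - x) h]. The
    boundary conditions thus become two orthogonality constraints, as [constrained_minimum]
    requires. *)
Lemma clampedP h : clamped h <-> dot h (ccst 1) = 0 /\ dot h (J (ccst 1)) = 0.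
Proof.
have e1 : J h b = dot h (ccst 1) by rewrite prim_b cdot1.
have e2 : L h b = J h b * (b - a) - dot h (J (ccst 1)).
  by rewrite /prim2 prim_b -cdot1 cdot_parts [J (ccst 1) b]prim_cst1 // leab lexx.
rewrite /clamped e2 -e1; split=> -[-> h2]; split => //; last by rewrite h2; ring.
by move: h2; rewrite mul0r; lra.
Qed.

Lemma cenergyC V h k : cenergy V h k = cenergy V k h.
Proof.
by rewrite !cenergyE cdotC cdot_cmul (cdotC _ _ (L h)).
Qed.

Lemma cenergyl V c u v w :
  cenergy V (c *: u + v) w = c * cenergy V u w + cenergy V v w.
Proof.
rewrite !cenergyE (prim2P c u v) (cmulP V c (L u) (L v)).
rewrite (cdotl a b c u v w) (cdotl a b c (cmul V (L u)) (cmul V (L v)) (L w)).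
by rewrite mulrDr addrACA.
Qed.

(** Testing with a clamped [k] kills the affine part [p + q (x - a)]. *)
Lemma reig_weak V m h k : reig V m h -> clamped k ->
  cenergy V h k = m * dot (L h) (L k).
Proof.
move=> [_ [p [q hE]]] ck; have [k1' k2'] := ck; have [k1 k2] := (clampedP k).1 ck.
pose w := m *: L h - cmul V (L h).
have -> : cenergy V h k = dot (p *: ccst 1 + (q *: J (ccst 1) + L w)) k
    + dot (cmul V (L h)) (L k).
  rewrite !cenergyE; congr (_ + _); apply: eq_cdot => // x xab.
  by rewrite hE // !cfunE prim_cst1 //= mulr1 addrA.
have wE : dot (L w) k = m * dot (L h) (L k) - dot (cmul V (L h)) (L k).
  rewrite cdotC -(prim2_sym w (conj k1' k2')) cdotC /w -scaleN1r addrC.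
  rewrite (cdotl a b (- 1) (cmul V (L h)) (m *: L h) (L k)).
  by rewrite (dotZl (@cdotl _ a b) m (L h)) mulN1r addrC.
rewrite (cdotl a b p) (cdotl a b q) wE (cdotC a b (ccst 1)) k1.
by rewrite (cdotC a b (J (ccst 1))) k2 !mulr0 !add0r subrK.
Qed.

Lemma reig_comb V m c h k : reig V m h -> reig V m k -> reig V m (c *: h + k).
Proof.
move=> [ch [p [q hE]]] [ck [p' [q' kE]]]; split; first exact: clamped_comb.
exists (c * p + p'), (c * q + q') => x xab.
rewrite !cfunE hE // kE //.
have -> : m *: L (c *: h + k) - cmul V (L (c *: h + k)) =
    c *: (m *: L h - cmul V (L h)) + (m *: L k - cmul V (L k)).
  rewrite (prim2P c h k) (cmulP V c (L h) (L k)) scalerDr scalerBr !scalerA (mulrC m) opprD.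
  by rewrite !addrA; congr (_ + _); rewrite addrAC.
rewrite (prim2P c (m *: L h - cmul V (L h)) (m *: L k - cmul V (L k))) !cfunE.
by move: (L _ x) (L _ x) => y z; ring.
Qed.

Lemma reig0 V m : reig V m 0.
Proof.
split; first exact: clamped0.
have L0 : L 0 = 0 by exact: linear0.
have V0 : cmul V 0 = 0 by exact: linear0.
by exists 0, 0 => x _; rewrite L0 V0 scaler0 subrr L0 !cfun0E mul0r !addr0.
Qed.

Lemma reig_sum V m (I : Type) (s : seq I) (F : I -> cfun R) (c : I -> R) :
  (forall i, reig V m (F i)) -> reig V m (\sum_(i <- s) c i *: F i).
Proof.
move=> hF; elim/big_rec: _ => [|i y _ cy]; first exact: reig0.
exact: (reig_comb (c i) (hF i) cy).
Qed.

Lemma reig_orth V m m' h k : reig V m h -> reig V m' k -> m != m' ->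
  dot (L h) (L k) = 0.
Proof.
move=> eh ek mm'; have := reig_weak eh ek.1.
rewrite cenergyC (reig_weak ek eh.1) (cdotC a b (L k) (L h)) => /eqP.
by rewrite -subr_eq0 -mulrBl mulf_eq0 subr_eq0 eq_sym (negPf mm') => /eqP.
Qed.

Section Rayleigh.
Variables (V : cfun R) (n : nat) (lam : nat -> R) (g : nat -> cfun R).
Hypothesis eg : forall i, (i < n)%N -> reig V (lam i) (g i).
Hypothesis og : forall i j, (i < n)%N -> (j < n)%N ->
  dot (L (g i)) (L (g j)) = (i == j)%:R.

Lemma reig_minimum u (M : R) : clamped u ->
  (forall j, (j < n)%N -> dot (L u) (L (g j)) = 0) ->
  dot (L u) (L u) = 1 -> cenergy V u u <= M ->
  exists (m : R) (h : cfun R), [/\ m <= M, reig V m h, dot (L h) (L h) = 1 &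
    forall j, (j < n)%N -> dot (L h) (L (g j)) = 0].
Proof.
move=> cu ou Nu Qu.
(* The first two entries encode the clamped conditions; [prim2_sym] turns orthogonality of [L h] to
   [L (g j)] into orthogonality of [h] to [L (L (g j))]. *)
pose s := [:: ccst 1, J (ccst 1) & mkseq (fun j => L (L (g j))) n].
have orthP h : orth dot s h <->
    clamped h /\ forall j, (j < n)%N -> dot (L h) (L (g j)) = 0.
  split=> [/orth_cons[h1 /orth_cons[h2 h3]]|[ch oh]].
    have ch : clamped h by apply/clampedP.
    split=> // j jn; rewrite prim2_sym //; apply: h3.
    by apply/mapP; exists j; rewrite ?mem_iota.
  have [h1 h2] := (clampedP h).1 ch.
  apply/orth_cons; split=> //; apply/orth_cons; split => //.
  move=> v /mapP[j]; rewrite mem_iota /= => jn ->.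
  by rewrite -prim2_sym // oh.
have [K K0 VK] := cfun_bounded ab V.
have symL h w : orth dot s h -> dot (L h) w = dot h (L w).
  by move=> /orthP[ch _]; exact: prim2_sym.
have ou' : orth dot s u by apply/orthP.
have [m [h [mM oh Nh wk]]] := constrained_minimum (@cdotC _ a b)
  (@cdotl _ a b) (@cdot_ge0 _ a b) (sqr_ge0 (b - a)) K0
  (nrm_prim2 ab) (fun u => nrm_cmul u K0 VK) (cdot_cmul a b V) symL
  (@compact_prim2 _ _ _ ab) ou' Nu Qu.
have [ch ohg] := (orthP h).1 oh.
exists m, h; split => //; split => //.
pose w := cmul V (L h) - m *: L h.
have dw k : dot w k = dot (cmul V (L h)) k - m * dot (L h) k.
  by rewrite /w (dotBl (@cdotl _ a b)) (dotZl (@cdotl _ a b)).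
have hw k : clamped k -> dot (h + L w) k = cenergy V h k - m * dot (L h) (L k).
  move=> ck; rewrite (dotDl (@cdotl _ a b)) (cdotC a b (L w)) -(prim2_sym w ck).
  by rewrite (cdotC a b (L k)) dw cenergyE addrA.
(* This projected Euler residual is null by the weak equation, so on [[a, b]] the function [h + L w]
   is a combination of the constraints. *)
pose r := orthproj dot s (h + L w).
have or : orth dot s r.
  by exact: (proj_orth (@cdotC _ a b) (@cdotl _ a b) (@cdot_ge0 _ a b)).
have [cr _] := (orthP r).1 or.
have r0 : dot r r = 0.
  rewrite {1}/r (dot_proj (@cdotC _ a b) (@cdotl _ a b) (@cdot_ge0 _ a b)) //.
  by rewrite hw // -wk // subrr.
have dr k : dot r k = 0.
  apply/eqP; rewrite -sqrf_eq0 eq_le sqr_ge0 andbT.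
  have := cauchy_schwarz (@cdotC _ a b) (@cdotl _ a b) (@cdot_ge0 _ a b) r k.
  by rewrite r0 mul0r.
have [c] := proj_span dot s (h + L w).
rewrite -/r /= !big_ord_recl /= size_mkseq.
have -> : \sum_(i < n) c (bump 0 (bump 0 i)) *:
    nth 0 (mkseq (fun j => L (L (g j))) n) i =
    \sum_(i < n) c i.+2 *: L (L (g i)).
  by apply: eq_bigr => i _; rewrite nth_mkseq.
set z := \sum_(i < n) _ => zE.
(* As [g j] is an eigenfunction, its energy against [h] is a multiple of [dot (L (g j)) (L h) = 0],
   so its multiplier vanishes. The two remaining multipliers are the [p] and [q] of [reig]. *)
have c0 (j : 'I_n) : c j.+2 = 0.
  have [gj1 gj2] := (clampedP (g j)).1 (eg (ltn_ord j)).1.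
  have : dot (h + L w) (g j) = 0.
    rewrite hw; last exact: (eg (ltn_ord j)).1.
    by rewrite cenergyC (reig_weak (eg (ltn_ord j)) ch) (cdotC a b (L (g j))) ohg // !mulr0 subrr.
  rewrite zE (dotDl (@cdotl _ a b)) dr add0r (cdotl a b (c 0%N)) (cdotl a b (c 1%N)).
  rewrite (cdotC a b (ccst 1)) gj1 (cdotC a b (J (ccst 1))) gj2 !mulr0 !add0r.
  rewrite /z (dot_suml (@cdotl _ a b)) (bigD1 j) //= big1 ?addr0 => [|i ij].
    rewrite (dotZl (@cdotl _ a b)) (cdotC a b) -prim2_sym; last exact: (eg (ltn_ord j)).1.
    by rewrite og // eqxx mulr1.
  rewrite (dotZl (@cdotl _ a b)) (cdotC a b) -prim2_sym; last exact: (eg (ltn_ord j)).1.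
  by rewrite og // -val_eqE eq_sym in ij *; rewrite (negPf ij) mulr0.
have z0 : z = 0 by rewrite /z big1 // => i _; rewrite c0 scale0r.
exists (c 0%N), (c 1%N) => x xab.
have rx : r x = 0 by exact: (cdot_eq0 ab r0).
have : (h + L w) x = r x + (c 0%N * 1 + c 1%N * J (ccst 1) x).
  by rewrite zE z0 addr0 !cfunE.
rewrite cfunDE rx add0r prim_cst1 // mulr1 => hx.
have -> : m *: L h - cmul V (L h) = - w by rewrite /w opprB.
by rewrite (linearN L) cfunNE -hx addrK.
Qed.

End Rayleigh.
End RealEigenfunctions.

(** * Equivalence of the operator graph with the integrated equation *)

Section GraphEigenfunctions.
Context {R : realType}.
Notation mu := (@lebesgue_measure R).
Variables (a b : R).
Hypothesis ab : a < b.
Let leab : a <= b := ltW ab.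
Implicit Types (u v w h k V : cfun R) (m x y p q c : R) (f g : R -> R).
Notation J := (prim ab).
Notation L := (prim2 ab).

Lemma primZ c u : J (c *: u) = c *: J u.
Proof. exact: linearZ. Qed.

Lemma primD u v : J (u + v) = J u + J v.
Proof. exact: linearD. Qed.

Lemma ae_imply (A B : R -> Prop) : {ae mu, forall x, A x} ->
  (forall x, A x -> B x) -> {ae mu, forall x, B x}.
Proof. by move=> hA AB; apply: (@filterS _ _ (ae_filter_ringOfSetsType mu) _ _ AB). Qed.

Lemma ac_deriv_cfun f g : ac_deriv_real a b f g ->
  exists w : cfun R, forall x, a <= x <= b -> w x = f x.
Proof.
move=> [ig fE].
have cg : continuous (fun x => f a + \int[mu]_(t in `[a, clamp a b x]) g t).
  move=> x; apply: cvgD; first exact: cvg_cst.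
  have := within_clamp_continuous leab (parameterized_integral_continuous leab ig).
  by apply.
exists (mkcfun cg) => x xab /=.
by rewrite clamp_id // -fE // in_itv.
Qed.

Lemma ac_deriv_prim f g w : ac_deriv_real a b f g ->
  {ae mu, forall x, x \in `[a, b] -> g x = w x} ->
  forall x, a <= x <= b -> f x = f a + J w x.
Proof.
move=> [ig fE] gw x /[dup] xab /andP[ax xb].
rewrite fE ?in_itv // primE // cintE; congr (_ + _).
have sub : `[a, x]%classic `<=` `[a, b]%classic by apply: subset_itvl; rewrite bnd_simp.
rewrite /Rintegral; congr fine; apply: ae_eq_integral => //.
- by apply: (measurable_int mu); apply: integrableS ig.
- by apply: (measurable_int mu); exact: cfun_integrable.
- by apply: ae_imply gw _ => t h tx; rewrite /= h //; exact: sub.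
Qed.

(** Integrating the almost everywhere equation for [D 4] makes each lower derivative known
    everywhere on [[a, b]]. Since the [D j] are arbitrary elsewhere, [D 0] is first replaced by a
    continuous [w0] on the line. *)
Lemma reig_of_derivs V m (D : nat -> R -> R) :
  (forall j, (j < 4)%N -> ac_deriv_real a b (D j) (D j.+1)) ->
  D 0%N a = 0 -> D 1%N a = 0 -> D 0%N b = 0 -> D 1%N b = 0 ->
  {ae mu, forall x, x \in `[a, b] -> D 4%N x = (m - V x) * D 0%N x} ->
  exists2 h, reig ab V m h & forall x, a <= x <= b -> D 0%N x = L h x.
Proof.
move=> hD D0a D1a D0b D1b ae4.
have aeE (f : R -> R) w : (forall x, a <= x <= b -> f x = w x) ->
    {ae mu, forall x, x \in `[a, b] -> f x = w x}.
  by move=> fw; apply: aeW => x; rewrite in_itv; exact: fw.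
have [w0 w0E] := ac_deriv_cfun (hD 0%N isT).
pose w := m *: w0 - cmul V w0.
have D3 x : a <= x <= b -> D 3%N x = D 3%N a + J w x.
  move=> xab; apply: (ac_deriv_prim (hD 3%N isT)) => //.
  apply: ae_imply ae4 _ => t ht tab; rewrite ht // /w !cfunE cmulE.
  by rewrite -w0E ?mulrBl // -in_itv.
have D2 x : a <= x <= b -> D 2%N x = D 2%N a + J (ccst (D 3%N a) + J w) x.
  move=> xab; apply: (ac_deriv_prim (hD 2%N isT)) => //.
  by apply: aeE => t tab; rewrite D3.
pose h : cfun R := ccst (D 2%N a) + J (ccst (D 3%N a) + J w).
have D2h x : a <= x <= b -> D 2%N x = h x by move=> xab; rewrite D2.
have D1 x : a <= x <= b -> D 1%N x = J h x.
  by move=> xab; rewrite (ac_deriv_prim (hD 1%N isT) (aeE _ _ D2h)) // D1a add0r.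
have D0 x : a <= x <= b -> D 0%N x = L h x.
  by move=> xab; rewrite (ac_deriv_prim (hD 0%N isT) (aeE _ _ D1)) // D0a add0r.
have bab : a <= b <= b by rewrite leab lexx.
exists h => //; split; first by rewrite /clamped -D1 // -D0.
exists (D 2%N a), (D 3%N a) => x xab.
have -> : h x = D 2%N a + (J (ccst (D 3%N a)) x + L w x).
  by rewrite /h cfunDE primD.
have -> : ccst (D 3%N a) = D 3%N a *: ccst 1.
  by apply: cfun_eqP => t; rewrite cfunZE /= mulr1.
rewrite primZ cfunZE prim_cst1 // addrA; congr (_ + _).
apply: eq_prim2 => t tab.
by rewrite /w !cfunE !cmulE w0E // D0.
Qed.

Lemma ac_deriv_real_cfun v w : (forall x, a <= x <= b -> v x = v a + J w x) ->
  ac_deriv_real a b v w.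
Proof.
move=> vE; split; first exact: cfun_integrable.
by move=> x; rewrite in_itv /= => xab; rewrite vE // primE // cintE.
Qed.

Lemma L2_cfun w : L2 a b (fun x => (w x)%:C).
Proof.
split=> /=.
- by have := measurable_int mu (cfun_integrable a b w); move/measurable_EFinP.
- exact: measurable_cst.
rewrite /L2normsq /=.
have /integrableP[_] := cfun_integrable a b (cmul w w).
rewrite (_ : (fun x => (w x ^+ 2 + 0 ^+ 2)%:E) = (fun x => `|(EFin \o cmul w w) x|%E)) //.
apply/funext => x /=.
by rewrite cmulE -expr2 ger0_norm ?sqr_ge0 // expr0n addr0.
Qed.

Variables (U P : R -> R) (V : cfun R).
Hypothesis VE : forall x, a <= x <= b -> V x = U x + P x.

Lemma graph_of_reig m h : reig ab V m h ->
  op_graph a b U P (fun x => (L h x)%:C) (fun x => m%:C * (L h x)%:C).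
Proof.
move=> [[h1 h2] [p [q hE]]].
pose w := m *: L h - cmul V (L h).
(* The fourth derivative [w] is the default value of [nth]. *)
pose D j : cfun R := nth w [:: L h; J h; h; ccst q + J w] j.
have aab : a <= a <= b by rewrite lexx leab.
have ha : h a = p by rewrite hE // subrr mulr0 addr0 /prim2 prim_a addr0.
have acD j : (j < 4)%N -> ac_deriv_real a b (D j) (D j.+1).
  case: j => [|[|[|[|//]]]] _.
  - change (ac_deriv_real a b (L h) (J h)); apply: ac_deriv_real_cfun => x xab.
    by rewrite /prim2 prim_a add0r.
  - change (ac_deriv_real a b (J h) h); apply: ac_deriv_real_cfun => x xab.
    by rewrite prim_a add0r.
  - change (ac_deriv_real a b h (ccst q + J w)); apply: ac_deriv_real_cfun => x xab.
    have qE : ccst q = q *: ccst 1 by apply: cfun_eqP => t; rewrite cfunZE /= mulr1.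
    by rewrite ha primD qE primZ cfunDE cfunZE prim_cst1 // hE // -/w addrA.
  - change (ac_deriv_real a b (ccst q + J w) w); apply: ac_deriv_real_cfun => x xab.
    by rewrite !cfunDE prim_a addr0.
exists (fun j x => (D j x)%:C); split.
- split=> [//|j j4|]; last exact: L2_cfun.
  split; first exact: acD.
  split=> /=.
    exact: (cfun_integrable a b 0).
  by move=> x _; rewrite add0r Rintegral_cst //= mul0r.
- by rewrite /D /= prim_a /prim2 prim_a.
- by rewrite /D /= h1 h2.
- apply: aeW => x xab; rewrite in_itv /= in xab.
  rewrite -!rmorphM -!rmorphD; congr (_%:C).
  by rewrite (_ : D 4%N = w) // /w !cfunE cmulE VE //; ring.
Qed.

(** [m] and the potential are real, so the real and imaginary parts solve the equation
    separately. *)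
Lemma reig_of_graph m (f : R -> R[i]) :
  op_graph a b U P f (fun x => m%:C * f x) ->
  exists hr hi, [/\ reig ab V m hr, reig ab V m hi &
    forall x, a <= x <= b -> f x = (L hr x +i* L hi x)%C].
Proof.
move=> [d [[f0 acd _] [d0a d1a] [d0b d1b] ae]].
have fE x : a <= x <= b -> d 0%N x = f x by move=> xab; apply: f0; rewrite in_itv.
have [||||||hr ehr hrE] := @reig_of_derivs V m (fun j x => complex.Re (d j x)).
- by move=> j /acd[].
- by rewrite d0a.
- by rewrite d1a.
- by rewrite d0b.
- by rewrite d1b.
- apply: ae_imply ae _ => x h /[dup] xab /h; rewrite in_itv /= in xab.
  rewrite -fE // VE //.
  case: (d 0%N x) (d 4%N x) => [u0 v0] [u4 v4] /= [+ _]; lra.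
have [||||||hi ehi hiE] := @reig_of_derivs V m (fun j x => complex.Im (d j x)).
- by move=> j /acd[].
- by rewrite d0a.
- by rewrite d1a.
- by rewrite d0b.
- by rewrite d1b.
- apply: ae_imply ae _ => x h /[dup] xab /h; rewrite in_itv /= in xab.
  rewrite -fE // VE //.
  case: (d 0%N x) (d 4%N x) => [u0 v0] [u4 v4] /= [_ +]; lra.
exists hr, hi; split => // x xab; rewrite -hrE // -hiE // -fE //.
by case: (d 0%N x).
Qed.

End GraphEigenfunctions.
(** * Min-max estimates *)

Lemma card_seq_uniq (t : seq nat) : uniq t -> ([set` t] #= `I_(size t))%card.
Proof.
move=> ut; apply: card_esym; apply/card_set_bijP; exists (nth 0%N t); split.
- by move=> i it; apply: mem_nth.
- by move=> i j; rewrite !inE => it jt /eqP; rewrite nth_uniq // => /eqP.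
- by move=> x xt; exists (index x t); [rewrite /= index_mem|rewrite nth_index].
Qed.

(** More unknowns than equations. The field is general because the dimension counts below use both
    real and complex coefficients. *)
Lemma exists_null_comb (F : fieldType) (p m : nat) (A : 'I_p -> 'I_m -> F) :
  (m < p)%N -> exists c : 'I_p -> F,
    (exists i, c i != 0) /\ forall j, \sum_i c i * A i j = 0.
Proof.
move=> mp; pose B := \matrix_(i < p, j < m) A i j.
have kB : kermx B != 0.
  by rewrite -mxrank_eq0 mxrank_ker subn_eq0 -ltnNge (leq_ltn_trans (rank_leq_col B)).
pose v := nz_row (kermx B).
have v0 : v != 0 by rewrite nz_row_eq0.
have vB : v *m B = 0 by apply/sub_kermxP; exact: nz_row_sub.
exists (fun i => v 0 i); split.
  have [i vi] : exists i, v 0 i != 0 by apply/rV0Pn.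
  by exists i.
move=> j; transitivity ((v *m B) 0 j); last by rewrite vB mxE.
by rewrite mxE; apply: eq_bigr => i _; rewrite mxE.
Qed.

Lemma sum_complex (R : realType) (I : Type) (s : seq I) (x y : I -> R) :
  \sum_(i <- s) (x i +i* y i)%C = ((\sum_(i <- s) x i) +i* (\sum_(i <- s) y i))%C.
Proof. by elim/big_rec3: _ => // i x1 x2 z _ ->. Qed.

Lemma mul_complexE (R : realType) (c : R[i]) (x y : R) :
  c * (x +i* y)%C = ((complex.Re c * x - complex.Im c * y)
    +i* (complex.Re c * y + complex.Im c * x))%C.
Proof. by case: c. Qed.

Section MinMax.
Context {R : realType}.
Variables (a b : R).
Hypothesis ab : a < b.
Implicit Types (u v w h k : cfun R) (m x y p q c : R).
Notation dot := (cdot a b).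
Notation L := (prim2 ab).

Lemma prim2Z c u : L (c *: u) = c *: L u.
Proof. exact: linearZ. Qed.

Lemma cenergyZl V c u v : cenergy ab V (c *: u) v = c * cenergy ab V u v.
Proof.
rewrite !cenergyE prim2Z (dotZl (@cdotl _ a b)) mulrDr; congr (_ + _).
have -> : cmul V (c *: L u) = c *: cmul V (L u) by exact: linearZ.
by rewrite (dotZl (@cdotl _ a b)).
Qed.

Lemma prim2_sum (I : Type) (s : seq I) (F : I -> cfun R) (c : I -> R) :
  L (\sum_(i <- s) c i *: F i) = \sum_(i <- s) c i *: L (F i).
Proof.
elim/big_rec2: _ => [|i y1 y2 _ <-]; first by rewrite /prim2 !linear0.
by rewrite prim2P.
Qed.

Lemma cdot_comb (I : Type) (s : seq I) (F : I -> cfun R) (c : I -> R) w :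
  dot (\sum_(i <- s) c i *: F i) w = \sum_(i <- s) c i * dot (F i) w.
Proof.
rewrite (dot_suml (@cdotl _ a b)); apply: eq_bigr => i _.
by rewrite (dotZl (@cdotl _ a b)).
Qed.

Variables (U P : R -> R) (V : cfun R).
Hypothesis VE : forall x, a <= x <= b -> V x = U x + P x.
Variable lam : nat -> R.
Hypothesis en : eigenvalue_enum a b (op_graph a b U P) lam.

Lemma lam_mono i j : (i <= j)%N -> lam i <= lam j.
Proof. by move=> ij; apply: en.1. Qed.

(** Restates the multiplicity clause of [eigenvalue_enum] for a real [m]: a complex basis of the
    eigenspace, written with real eigenfunctions, whose size is the number of indices listing
    [m]. *)
Lemma reig_span m : exists (p : nat) (hr hi : 'I_p -> cfun R),
  [/\ ([set k | (lam k)%:C = m%:C] #= `I_p)%card,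
    forall i, reig ab V m (hr i) /\ reig ab V m (hi i),
    (forall c : 'I_p -> R[i], (forall x, a <= x <= b ->
      \sum_i c i * (L (hr i) x +i* L (hi i) x)%C = 0) -> forall i, c i = 0) &
    forall h, reig ab V m h -> exists c : 'I_p -> R[i], forall x, a <= x <= b ->
      (L h x)%:C = \sum_i c i * (L (hr i) x +i* L (hi i) x)%C].
Proof.
have [p [[e [eE ind sp]] cp]] := en.2 m%:C.
have /choice [hr hrP] : forall i, exists hr, exists hi,
    [/\ reig ab V m hr, reig ab V m hi &
    forall x, a <= x <= b -> e i x = (L hr x +i* L hi x)%C].
  by move=> i; exact: reig_of_graph (eE i).
have [hi hP] := choice hrP.
have eL i x : a <= x <= b -> e i x = (L (hr i) x +i* L (hi i) x)%C.
  by have [_ _] := hP i; apply.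
exists p, hr, hi; split => //.
- by move=> i; have [] := hP i.
- move=> c hc; apply: ind => x; rewrite in_itv => xab.
  by rewrite -[RHS](hc x xab); apply: eq_bigr => i _; rewrite eL.
- move=> h eh; have [c cE] := sp _ (graph_of_reig VE eh).
  exists c => x xab; rewrite cE ?in_itv //.
  by apply: eq_bigr => i _; rewrite eL.
Qed.

Lemma cdot_prim2_gt0 h x : a <= x <= b -> L h x != 0 -> 0 < dot (L h) (L h).
Proof.
move=> xab; rewrite lt_neqAle cdot_ge0 andbT; apply: contra => /eqP/esym h0.
by rewrite (cdot_eq0 ab h0).
Qed.

Lemma normalize h : 0 < dot (L h) (L h) -> exists c : R,
  dot (L (c *: h)) (L (c *: h)) = 1 /\ c ^+ 2 * dot (L h) (L h) = 1.
Proof.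
move=> N0; exists (nrm (cdot a b) (L h))^-1.
have e : (nrm (cdot a b) (L h))^-1 ^+ 2 * dot (L h) (L h) = 1.
  by rewrite exprVn sqr_cnrm mulVf // gt_eqF.
split => //; rewrite prim2Z (dotZl (@cdotl _ a b)).
by rewrite (dotZr (@cdotC _ a b) (@cdotl _ a b)) mulrA -expr2.
Qed.

Definition eigenfamily n (g : nat -> cfun R) :=
  (forall i, (i < n)%N -> reig ab V (lam i) (g i)) /\
  (forall i j, (i < n)%N -> (j < n)%N -> dot (L (g i)) (L (g j)) = (i == j)%:R).

(* The eigenspaces are complex, but closed under conjugation: a complex combination
   orthogonal to the previous real eigenfunctions has an orthogonal real or
   imaginary part. *)
Lemma eigenfamily_exists n : exists g, eigenfamily n g.
Proof.
elim: n => [|n [g [eg og]]]; first by exists (fun=> 0); split.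
have [p [hr [hi [cp eh ind _]]]] := reig_span (lam n).
pose s := [seq j <- iota 0 n | lam j == lam n].
have sP j : j \in s -> (j < n)%N /\ lam j = lam n.
  by rewrite mem_filter mem_iota => /andP[/eqP].
(* Besides the indices in [s], the index [n] also lists the value [lam n]. *)
have sp : (size s < p)%N.
  have un : uniq (n :: s).
    by rewrite /= filter_uniq ?iota_uniq // mem_filter mem_iota ltnn !andbF.
  have := card_seq_uniq un; rewrite -[(size s < p)%N]card_le_II => sc.
  rewrite -(card_le_eql sc) -(card_le_eqr cp); apply: subset_card_le => j.
  by rewrite /= inE => /predU1P[->//|/sP[_ ->]].
pose A (i : 'I_p) (j : 'I_(size s)) :=
  (dot (L (hr i)) (L (g (nth 0%N s j))) +i* dot (L (hi i)) (L (g (nth 0%N s j))))%C.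
have [c [[i0 ci0] cA]] := exists_null_comb A sp.
(* Real part of [z c_i (hr i + i hi i)]: [z = 1] and [z = -i] give the real and imaginary parts of
   the complex combination. *)
pose F z i := complex.Re (z * c i) *: hr i + (- complex.Im (z * c i)) *: hi i.
pose hh z := \sum_i 1 *: F z i.
have eF z i : reig ab V (lam n) (F z i).
  have [e1 e2] := eh i; apply: reig_comb => //.
  by rewrite -[_ *: _]addr0; apply: reig_comb => //; exact: reig0.
have ehh z : reig ab V (lam n) (hh z) by exact: reig_sum.
have LF z x : L (hh z) x = complex.Re (z * \sum_i c i * (L (hr i) x +i* L (hi i) x)%C).
  rewrite /hh prim2_sum cfun_sumE mulr_sumr.
  under [in RHS]eq_bigr do rewrite mulrA mul_complexE.
  rewrite sum_complex; apply: eq_bigr => i _.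
  by rewrite scale1r /F prim2P prim2Z !cfunE mulNr.
have dF z w : dot (L (hh z)) w =
    complex.Re (z * \sum_i c i * (dot (L (hr i)) w +i* dot (L (hi i)) w)%C).
  rewrite /hh prim2_sum cdot_comb mulr_sumr.
  under [in RHS]eq_bigr do rewrite mulrA mul_complexE.
  rewrite sum_complex; apply: eq_bigr => i _.
  rewrite mul1r /F prim2P prim2Z (cdotl a b) (dotZl (@cdotl _ a b)).
  by rewrite mulNr.
have ohh z j : (j < n)%N -> dot (L (hh z)) (L (g j)) = 0.
  move=> jn; have [ej|nj] := eqVneq (lam j) (lam n); last first.
    by rewrite cdotC; apply: reig_orth (eg j jn) (ehh z) nj.
  have js : j \in s by rewrite mem_filter ej eqxx mem_iota.
  have jl : (index j s < size s)%N by rewrite index_mem.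
  by have := cA (Ordinal jl); rewrite dF /A /= nth_index // => ->; rewrite mulr0.
have [z Nz] : exists z, 0 < dot (L (hh z)) (L (hh z)).
  apply: contrapT => none; move/negP: ci0; apply; apply/eqP; apply: ind => x xab.
  have Lz z : L (hh z) x = 0.
    by apply: contrapT => /eqP h; apply: none; exists z; exact: cdot_prim2_gt0 h.
  have := Lz (0 -i* 1)%C; have := Lz 1; rewrite !LF mul1r.
  by case: (\sum_i _) => re im /= -> /=; rewrite !(mul0r, mulr0, oppr0, sub0r) mulNr mul1r opprK => ->.
have [k [Nk _]] := normalize Nz.
have ek : reig ab V (lam n) (k *: hh z).
  by rewrite -[_ *: _]addr0; apply: reig_comb => //; exact: reig0.
exists (fun i => if (i < n)%N then g i else k *: hh z); split.
  move=> i; rewrite ltnS leq_eqVlt => /predU1P[->|lin]; first by rewrite ltnn.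
  by rewrite lin; exact: eg.
have onew j : (j < n)%N -> dot (L (k *: hh z)) (L (g j)) = 0.
  by move=> jn; rewrite prim2Z (dotZl (@cdotl _ a b)) ohh // mulr0.
move=> i j; rewrite !ltnS (leq_eqVlt i n) (leq_eqVlt j n).
move=> /predU1P[->|lin] /predU1P[->|ljn]; rewrite ?ltnn ?eqxx ?lin ?ljn.
- by rewrite Nk.
- by rewrite onew // gtn_eqF.
- by rewrite cdotC onew // ltn_eqF.
- by rewrite og.
Qed.

(** Suppose [M < lam k]. Some [w] in the span of the [u i] has [L w] orthogonal to the [L (g j)] for
    the first [k] eigenfunctions [g j], so [reig_minimum] yields a new eigenfunction [h] for some
    [m <= M], orthogonal to them. With the [g j] of eigenvalue [m] it gives more independent
    eigenfunctions than indices listing [m]. *)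
Lemma eig_le (k : nat) (M : R) (u : 'I_k.+1 -> cfun R) :
  (forall i, clamped ab (u i)) ->
  (forall c : 'I_k.+1 -> R, let w := \sum_i c i *: u i in
    cenergy ab V w w <= M * dot (L w) (L w)) ->
  (forall c : 'I_k.+1 -> R, let w := \sum_i c i *: u i in
    dot (L w) (L w) = 0 -> forall i, c i = 0) ->
  lam k <= M.
Proof.
move=> cu uM uN; rewrite leNgt; apply/negP => Mk.
have [g [eg og]] := eigenfamily_exists k.
have [c [[i0 ci0] hc]] :=
  exists_null_comb (fun i (j : 'I_k) => dot (L (u i)) (L (g j))) (ltnSn k).
pose w := \sum_i c i *: u i.
have Nw : 0 < dot (L w) (L w).
  rewrite lt_neqAle cdot_ge0 andbT; apply/eqP => /esym w0.
  by move/eqP: ci0; apply; exact: uN w0 i0.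
have [z [Nz zE]] := normalize Nw.
have cw : clamped ab (z *: w).
  by rewrite -[_ *: _]addr0; apply: clamped_comb; [exact: clamped_sum|exact: clamped0].
have ow j : (j < k)%N -> dot (L (z *: w)) (L (g j)) = 0.
  move=> jk; rewrite prim2Z (dotZl (@cdotl _ a b)) /w prim2_sum cdot_comb.
  by have := hc (Ordinal jk) => /= ->; rewrite mulr0.
have Qw : cenergy ab V (z *: w) (z *: w) <= M.
  rewrite cenergyZl cenergyC cenergyZl mulrA -expr2 -[M]mulr1 -zE mulrCA.
  by apply: ler_wpM2l; [exact: sqr_ge0|exact: uM].
have [m [h [mM eh Nh oh]]] := reig_minimum eg og cw ow Nz Qw.
have [p [hr [hi [cp _ _ sp]]]] := reig_span m.
pose s := [seq j <- iota 0 k | lam j == m].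
have sP j : j \in s -> (j < k)%N /\ lam j = m.
  by rewrite mem_filter mem_iota => /andP[/eqP].
have us : uniq s by rewrite filter_uniq ?iota_uniq.
(* Every index listing [m] is below [k], by monotonicity and [m < lam k], hence is in [s]. *)
have ps : (p <= size s)%N.
  rewrite -[(p <= _)%N]card_le_II -(card_le_eql cp) -(card_le_eqr (card_seq_uniq us)).
  apply: subset_card_le => j /= /(congr1 (@complex.Re R)) /= ljm.
  rewrite mem_filter ljm eqxx mem_iota /= add0n ltnNge; apply/negP => /lam_mono.
  by rewrite ljm leNgt (le_lt_trans mM Mk).
pose G (j : 'I_(size s).+1) := if j is Ordinal j'.+1 _ then g (nth 0%N s j') else h.
have eG j : reig ab V m (G j).
  case: j => [[|j] //= js]; have [jk <-] := sP _ (mem_nth 0%N js); exact: eg.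
have oG i j : dot (L (G i)) (L (G j)) = (i == j)%:R.
  case: i j => [[|i] li] [[|j] lj] //=.
  - by rewrite oh //; have [] := sP _ (mem_nth 0%N lj).
  - by rewrite cdotC oh //; have [] := sP _ (mem_nth 0%N li).
  - rewrite og ?(sP _ (mem_nth 0%N lj)).1 ?(sP _ (mem_nth 0%N li)).1 //.
    by rewrite nth_uniq.
have [cc ccP] := choice (fun j => sp _ (eG j)).
have [d [[j0 dj0] hd]] := exists_null_comb cc (ps : (p < (size s).+1)%N).
have dG x : a <= x <= b -> \sum_j d j * (L (G j) x)%:C = 0.
  move=> xab.
  under eq_bigr do rewrite ccP // mulr_sumr.
  rewrite exchange_big big1 //= => i _.
  by under eq_bigr do rewrite mulrA; rewrite -mulr_suml hd mul0r.
(* The [G j] are real, so the complex relation splits into two real ones, each excluded by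
   orthonormality. *)
have real_null (r : 'I_(size s).+1 -> R) :
    (forall x, a <= x <= b -> \sum_j r j * L (G j) x = 0) -> r j0 = 0.
  move=> hr0; pose v := \sum_j r j *: L (G j).
  have v0 x : a <= x <= b -> v x = (0 : cfun R) x.
    by move=> xab; rewrite /v cfun_sumE -[RHS](hr0 x xab); apply: eq_bigr.
  have : dot v (L (G j0)) = 0.
    by rewrite (eq_cdot v0 (fun x _ => erefl)) (dot0l (@cdotl _ a b)).
  rewrite /v cdot_comb (bigD1 j0) //= oG eqxx mulr1 big1 ?addr0 // => j jj0.
  by rewrite oG (negPf jj0) mulr0.
move/eqP: dj0; apply; apply/eqP; rewrite eq_complex; apply/andP; split; apply/eqP.
  apply: (real_null (fun j => complex.Re (d j))) => x /dG.
  under eq_bigr do rewrite mul_complexE.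
  by rewrite sum_complex => -[+ _]; under eq_bigr do rewrite mulr0 subr0.
apply: (real_null (fun j => complex.Im (d j))) => x /dG.
under eq_bigr do rewrite mul_complexE.
by rewrite sum_complex => -[_ +]; under eq_bigr do rewrite mulr0 add0r.
Qed.

End MinMax.

(** * Lower bounds and comparison of eigenvalues *)

Section EigenvalueBounds.
Context {R : realType}.
Variables (a b : R).
Hypothesis ab : a < b.
Implicit Types (u v w h V : cfun R) (m x y p q c d : R).
Notation dot := (cdot a b).
Notation J := (prim ab).
Notation L := (prim2 ab).

Lemma cintZ k u : cint a b (k *: u) = k * cint a b u.
Proof. exact: linearZ. Qed.

Lemma cintD u v : cint a b (u + v) = cint a b u + cint a b v.
Proof. exact: linearD. Qed.

Lemma cintN u : cint a b (- u) = - cint a b u.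
Proof. exact: linearN. Qed.

Lemma cdot_pot_le V (f : cfun R) (k : R) :
  (forall x, a <= x <= b -> V x * f x ^+ 2 <= k * f x ^+ 2) ->
  dot (cmul V f) f <= k * dot f f.
Proof.
move=> h; rewrite !cdotE -cintZ.
by apply: le_cint => x xab; rewrite cfunZE !cmulE -mulrA -expr2 h.
Qed.

Lemma prim_lip u (k : R) x y : a <= y -> y <= x -> x <= b ->
  (forall s, y <= s <= x -> `|u s| <= k) -> `|J u x - J u y| <= k * (x - y).
Proof.
move=> ay yx xb uk.
rewrite !primE ?ay ?(le_trans yx) ?(le_trans ay) // (@cint_split _ y a x) ?ay //.
rewrite addrAC subrr add0r ler_norml -mulNr -!cint_cst //.
by apply/andP; split; apply: le_cint => s sx /=; have := uk s sx; rewrite ler_norml => /andP[].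
Qed.

(** From its zero at [t], [J h] is at most [d^(1/2) |h|] within distance [d]; integrating over a
    length at most [d] gives [d^(3/2) |h|] for [L h]. *)
Lemma prim2_near_zero h (d : R) x t : a <= x <= b -> a <= t <= b -> `|x - t| <= d ->
  J h t = 0 -> L h t = 0 -> L h x ^+ 2 <= d ^+ 3 * dot h h.
Proof.
move=> /andP[ax xb] /andP[at_ tb] xt Jt Lt.
have d0 : 0 <= d by rewrite (le_trans _ xt).
pose k := Num.sqrt (d * dot h h).
have k0 : 0 <= k by exact: sqrtr_ge0.
have Jk s : `|s - t| <= d -> `|J h s| <= k.
  move=> st; rewrite -sqrtr_sqr ler_sqrt ?mulr_ge0 ?cdot_ge0 //.
  have := prim_holder ab h s t; rewrite Jt subr0 => /le_trans; apply.
  by rewrite ler_wpM2r ?cdot_ge0.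
have Lk : `|L h x| <= k * d.
  rewrite -[L h x]subr0 -Lt /prim2; have [tx|/ltW tx] := leP t x.
    apply: le_trans (@prim_lip _ k _ _ at_ tx xb _) _.
      move=> s /andP[ts sx]; apply: Jk; apply: le_trans xt.
      by rewrite !ger0_norm ?subr_ge0 // lerD2r.
    by rewrite ler_wpM2l // (le_trans (ler_norm _)).
  rewrite distrC; apply: le_trans (@prim_lip _ k _ _ ax tx tb _) _.
    move=> s /andP[xs st]; apply: Jk; apply: le_trans xt.
    by rewrite !(distrC _ t) !ger0_norm ?subr_ge0 // lerD2l lerN2.
  by rewrite ler_wpM2l // (le_trans (ler_norm _)) // distrC.
rewrite -[leLHS]real_normK ?num_real //.
apply: (@le_trans _ _ ((k * d) ^+ 2)).
  by rewrite ler_pXn2r ?nnegrE ?mulr_ge0.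
rewrite exprMn sqr_sqrtr ?mulr_ge0 ?cdot_ge0 //.
by rewrite le_eqVlt; apply/orP; left; apply/eqP; ring.
Qed.

Section Enumeration.
Variables (U P : R -> R) (V : cfun R).
Hypothesis VE : forall x, a <= x <= b -> V x = U x + P x.
Variable lam : nat -> R.
Hypothesis en : eigenvalue_enum a b (op_graph a b U P) lam.

Lemma eigenfamily_comb n (g : nat -> cfun R) (c : 'I_n -> R) :
  eigenfamily ab V lam n g -> let w := \sum_(i < n) c i *: g i in
  dot (L w) (L w) = \sum_(i < n) c i ^+ 2 /\
  cenergy ab V w w = \sum_(i < n) lam i * c i ^+ 2.
Proof.
move=> [eg og] w.
have dw (i : 'I_n) : dot (L (g i)) (L w) = c i.
  rewrite cdotC /w prim2_sum cdot_comb (bigD1 i) //= og // eqxx mulr1.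
  rewrite big1 ?addr0 // => j ji.
  by rewrite og // (inj_eq val_inj) (negPf ji) mulr0.
split.
  transitivity (dot (\sum_(i < n) c i *: L (g i)) (L w)); first by rewrite -prim2_sum.
  by rewrite cdot_comb; apply: eq_bigr => i _; rewrite dw expr2.
have cw : clamped ab w by apply: clamped_sum => i; exact: (eg i (ltn_ord i)).1.
have cE v : cenergy ab V w v = \sum_(i < n) c i * cenergy ab V (g i) v.
  rewrite /w; elim/big_rec2: _ => [|i y1 y2 _ <-].
    by rewrite -(scale0r 0) cenergyZl mul0r.
  by rewrite cenergyl.
rewrite cE; apply: eq_bigr => i _.
by rewrite (reig_weak (eg i (ltn_ord i)) cw) dw mulrCA -expr2.
Qed.

Lemma eigenfamily_energy_le n (g : nat -> cfun R) (c : 'I_n.+1 -> R) :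
  eigenfamily ab V lam n.+1 g -> let w := \sum_(i < n.+1) c i *: g i in
  cenergy ab V w w <= lam n * dot (L w) (L w).
Proof.
move=> fg /=; have [-> ->] := eigenfamily_comb c fg.
rewrite mulr_sumr; apply: ler_sum => i _; rewrite ler_wpM2r ?sqr_ge0 //.
by apply: (lam_mono en); rewrite -ltnS.
Qed.

(* Some combination of [2n + 1] eigenfunctions vanishes with its derivative at the
   [n] points of the net [t]. *)
Lemma eig_lower n (V1 V2 : cfun R) (t : 'I_n -> R) (c c' K C d : R) :
  (forall x, a <= x <= b -> V x = V1 x + V2 x) ->
  (forall x, a <= x <= b -> `|V1 x| <= C) ->
  a <= c -> c <= c' -> c' <= b -> 0 <= K ->
  (forall x, c <= x <= c' -> `|V2 x| <= K) ->
  (forall x, ~~ (c < x < c') -> V2 x = 0) ->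
  (forall i, a <= t i <= b) ->
  (forall x, c <= x <= c' -> exists i, `|x - t i| <= d) ->
  K * d ^+ 3 * (c' - c) <= 1 -> - C <= lam (n + n)%N.
Proof.
move=> VS V1C ac cc' c'b K0 V2K V20 tab tnet Kd.
have [g fg] := eigenfamily_exists ab VE en (n + n).+1; have [eg og] := fg.
pose A (i : 'I_(n + n).+1) (j : 'I_(n + n)) : R :=
  match fintype.split j with inl j => J (g i) (t j) | inr j => L (g i) (t j) end.
have [e [[i0 ei0] eA]] := exists_null_comb A (ltnSn _).
pose w := \sum_(i < (n + n).+1) e i *: g i.
have LS x : L w x = \sum_(i < (n + n).+1) e i * L (g i) x.
  by rewrite /w prim2_sum cfun_sumE; apply: eq_bigr.
have JS x : J w x = \sum_(i < (n + n).+1) e i * J (g i) x.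
  rewrite /w; elim/big_rec2: _ => [|i y1 y2 _ <-]; first by rewrite linear0.
  by rewrite primD primZ.
have Jw j : J w (t j) = 0.
  by rewrite JS -[RHS](eA (unsplit (inl j))); apply: eq_bigr => i _; rewrite /A unsplitK.
have Lw j : L w (t j) = 0.
  by rewrite LS -[RHS](eA (unsplit (inr j))); apply: eq_bigr => i _; rewrite /A unsplitK.
have [Nw _] := eigenfamily_comb e fg; rewrite -/w in Nw.
have Np : 0 < dot (L w) (L w).
  rewrite Nw (bigD1 i0) //= ltr_pwDl //; first by rewrite exprn_even_gt0.
  by apply: sumr_ge0 => i _; exact: sqr_ge0.
have Qw := eigenfamily_energy_le e fg; rewrite -/w in Qw.
have netL x : c <= x <= c' -> L w x ^+ 2 <= d ^+ 3 * dot w w.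
  move=> /[dup] /andP[cx xc'] /tnet [i xi].
  apply: (@prim2_near_zero w d x (t i)) => //.
  by rewrite (le_trans ac) // (le_trans xc').
(* The singular part is at most [K d^3 |w|^2] in size on an interval of length [c' - c], so the term
   [|w|^2] of the energy absorbs it. *)
have h2 : - dot w w <= dot (cmul V2 (L w)) (L w).
  rewrite lerNl cdotE -cintN.
  apply: (@le_trans _ _ (K * (d ^+ 3 * dot w w) * (c' - c))); last first.
    rewrite mulrA mulrAC; have := ler_wpM2r (cdot_ge0 a b w) Kd.
    by rewrite mul1r.
  apply: cint_bump => //.
    move=> x xc; rewrite cfunNE !cmulE -mulrA -expr2 -mulNr.
    apply: (@le_trans _ _ (K * L w x ^+ 2)); last by rewrite ler_wpM2l // netL.
    rewrite ler_wpM2r ?sqr_ge0 // (le_trans (ler_norm _)) // normrN V2K //.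
  by move=> x _ /V20 x0; rewrite cfunNE !cmulE x0 !mul0r oppr0.
have h1 : - C * dot (L w) (L w) <= dot (cmul V1 (L w)) (L w).
  rewrite mulNr lerNl.
  have -> : - dot (cmul V1 (L w)) (L w) = dot (cmul (- V1) (L w)) (L w).
    rewrite !cdotE -cintN; apply: eq_cint => x _.
    by rewrite cfunNE !cmulE cfunNE !mulNr.
  apply: cdot_pot_le => x xab; rewrite ler_wpM2r ?sqr_ge0 //.
  by rewrite (le_trans (ler_norm _)) // cfunNE normrN V1C.
have h3 : dot (cmul V (L w)) (L w) = dot (cmul V1 (L w)) (L w) + dot (cmul V2 (L w)) (L w).
  rewrite !cdotE -cintD; apply: eq_cint => x xab.
  by rewrite cfunDE !cmulE VS // !mulrDl.
rewrite -(ler_pM2r Np); apply: le_trans Qw; rewrite cenergyE h3.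
by move: h1 h2; rewrite mulNr; lra.
Qed.

End Enumeration.

(** The first [n + 1] eigenfunctions of one operator serve as test space in [eig_le] for the other;
    exchanging the operators gives a two-sided estimate. *)
Lemma eig_shift (U U' P P' : R -> R) V V' (lam lam' : nat -> R) (n : nat) (d : R) :
  (forall x, a <= x <= b -> V x = U x + P x) ->
  (forall x, a <= x <= b -> V' x = U' x + P' x) ->
  eigenvalue_enum a b (op_graph a b U P) lam ->
  eigenvalue_enum a b (op_graph a b U' P') lam' ->
  (forall x, a <= x <= b -> V' x <= V x + d) -> lam' n <= lam n + d.
Proof.
move=> VE VE' en en' Vd.
have [g fg] := eigenfamily_exists ab VE en n.+1; have [eg og] := fg.
apply: (@eig_le _ _ _ ab _ _ _ VE' _ en' n (lam n + d) (fun i => g i)).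
- by move=> i; exact: (eg i (ltn_ord i)).1.
- move=> c /=; have /= := eigenfamily_energy_le en c fg.
  set w := \sum_(i < n.+1) c i *: g i; rewrite !cenergyE mulrDl.
  have : dot (cmul V' (L w)) (L w) <= dot (cmul V (L w)) (L w) + d * dot (L w) (L w).
    rewrite !cdotE -cintZ -cintD.
    apply: le_cint => x xab; rewrite cfunDE cfunZE !cmulE -!mulrA -!expr2 -mulrDl.
    by rewrite ler_wpM2r ?sqr_ge0 // Vd.
  lra.
- move=> c w; have [-> _] := eigenfamily_comb c fg.
  move=> /eqP; rewrite psumr_eq0 => [/allP c0 i|i _]; last exact: sqr_ge0.
  by apply/eqP; rewrite -sqrf_eq0; apply: (c0 i); rewrite mem_index_enum.
Qed.

End EigenvalueBounds.

(** * Polynomial bumps and upper bounds on eigenvalues *)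

Section Bump.
Context {R : realType}.
Implicit Types (p q x : R).

(* [((x - p) (q - x))^3] and its derivatives, in point-free form for the sake of
   the [is_derive] instances. *)
Definition bump0 p q : R -> R := ((id - cst p) * (cst q - id)) ^+ 3.
Definition bump1 p q : R -> R :=
  3%:R *: (((id - cst p) * (cst q - id)) ^+ 2 * (cst (p + q) - 2%:R *: id)).
Definition bump2 p q : R -> R :=
  6%:R *: ((id - cst p) * (cst q - id) * (cst (p + q) - 2%:R *: id) ^+ 2)
  - 6%:R *: ((id - cst p) * (cst q - id)) ^+ 2.

Lemma expfctE (f : R -> R) n x : (f ^+ n) x = f x ^+ n.
Proof. by elim: n => [|n ih]; rewrite ?expr0 // !exprS /= -ih. Qed.

Lemma bump0E p q x : bump0 p q x = ((x - p) * (q - x)) ^+ 3.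
Proof. by rewrite /bump0 expfctE. Qed.

Lemma bump1E p q x :
  bump1 p q x = 3 * (((x - p) * (q - x)) ^+ 2 * (p + q - 2 * x)).
Proof. by []. Qed.

Lemma bump2E p q x : bump2 p q x =
  6 * ((x - p) * (q - x) * (p + q - 2 * x) ^+ 2) - 6 * ((x - p) * (q - x)) ^+ 2.
Proof. by []. Qed.

Lemma is_derive_bump0 p q x : is_derive x (1 : R) (bump0 p q) (bump1 p q x).
Proof.
apply: is_derive_eq; rewrite bump1E /GRing.scale /= !fctE /=; ring.
Qed.

Lemma is_derive_bump1 p q x : is_derive x (1 : R) (bump1 p q) (bump2 p q x).
Proof.
apply: is_derive_eq; rewrite bump2E /GRing.scale /= !fctE /=.
by rewrite (_ : 2%:R *: x = 2 * x) //; ring.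
Qed.

Lemma bump1_continuous p q : continuous (bump1 p q).
Proof.
move=> x; apply/differentiable_continuous/derivable1_diffP.
by apply: (@ex_derive _ _ _ _ _ _ _ (is_derive_bump1 p q x)).
Qed.

Lemma bump2_continuous p q : continuous (bump2 p q).
Proof.
by move=> x; apply/differentiable_continuous/derivable1_diffP; apply: ex_derive.
Qed.

(** With [s = (q - p)^2] and [t = (x - p) (q - x)], the second derivative is
    [6 t (s - 4 t) - 6 t^2], and [0 <= 4 t <= s] keeps it between [- 2 s^2] and [2 s^2]. *)
Lemma bump2_le p q x : p <= x <= q -> bump2 p q x ^+ 2 <= 4 * (q - p) ^+ 8.
Proof.
move=> /andP[px xq]; rewrite bump2E.
have -> : p + q - 2 * x = (q - x) - (x - p) by ring.
have -> : q - p = (x - p) + (q - x) by ring.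
have y0 : 0 <= x - p by rewrite subr_ge0.
have z0 : 0 <= q - x by rewrite subr_ge0.
move: (x - p) (q - x) y0 z0 => y z y0 z0.
pose l := y + z; pose t := y * z.
have t0 : 0 <= t by exact: mulr_ge0.
have dE : (z - y) ^+ 2 = l ^+ 2 - 4 * t by rewrite /l /t; ring.
rewrite -/t -/l dE.
have tl : 4 * t <= l ^+ 2 by rewrite -subr_ge0 -dE sqr_ge0.
have -> : 4 * l ^+ 8 = (2 * (l ^+ 2) ^+ 2) ^+ 2 by ring.
move: (l ^+ 2) tl => s tl.
have s0 : 0 <= s by lra.
have ss0 : 0 <= 2 * s ^+ 2 by apply: mulr_ge0 => //; exact: sqr_ge0.
rewrite -[leLHS]real_normK ?num_real // ler_pXn2r ?nnegrE //.
rewrite ler_norml.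
have h1 := mulr_ge0 t0 s0.
have h2 := mulr_ge0 t0 (_ : 0 <= s - 4 * t); rewrite subr_ge0 tl in h2.
have h3 := mulr_ge0 s0 (_ : 0 <= s - 4 * t); rewrite subr_ge0 tl in h3.
have {}h2 := h2 isT; have {}h3 := h3 isT; have h4 := sqr_ge0 t.
by apply/andP; split; rewrite expr2 in h4 *; rewrite ?expr2; lra.
Qed.

Lemma bump0_ge p q x : p + (q - p) / 4 <= x <= q - (q - p) / 4 ->
  p < q -> (q - p) ^+ 12 / 16 ^+ 6 <= bump0 p q x ^+ 2.
Proof.
move=> /andP[px xq] pq; rewrite bump0E.
have l0 : 0 < q - p by rewrite subr_gt0.
have -> : (q - p) ^+ 12 / 16 ^+ 6 = (((q - p) / 4 * ((q - p) / 4)) ^+ 3) ^+ 2 by field.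
have d0 : 0 <= (q - p) / 4 by rewrite divr_ge0 // ltW.
have h : (q - p) / 4 * ((q - p) / 4) <= (x - p) * (q - x).
  by apply: ler_pM => //; lra.
have h0 : 0 <= (q - p) / 4 * ((q - p) / 4) by exact: mulr_ge0.
have h1 := le_trans h0 h.
by rewrite -!exprM ler_pXn2r ?nnegrE.
Qed.

Variables (a b : R).
Hypothesis ab : a < b.
Notation dot := (cdot a b).
Notation J := (prim ab).
Notation L := (prim2 ab).

(** [F q = 0] makes the primitive vanish beyond [q]. The conclusion repeats the form of the
    hypotheses on [u], so that the lemma can be applied twice, from [bump2] to [bump1] to
    [bump0]. *)
Lemma prim_supp (u v : cfun R) (F : R -> R) p q : a <= p -> p < q -> q <= b ->
  (forall x, p <= x <= q -> u x = v x) ->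
  (forall x, a <= x <= b -> ~~ (p < x < q) -> u x = 0) ->
  (forall x, is_derive x (1 : R) F (v x)) -> F p = 0 -> F q = 0 ->
  (forall x, p <= x <= q -> J u x = F x) /\
  (forall x, a <= x <= b -> ~~ (p < x < q) -> J u x = 0).
Proof.
move=> ap pq qb uv u0 dF Fp Fq.
have zero c d : a <= c -> d <= b -> (forall x, c <= x <= d -> ~~ (p < x < q)) ->
    cint c d u = 0.
  move=> ac db h; rewrite -(linear0 (cint c d)); apply: eq_cint => x /[dup] xcd /andP[cx xd].
  by apply: u0; [rewrite (le_trans ac) // (le_trans xd)|exact: h].
have low x : a <= x -> x <= p -> cint a x u = 0.
  move=> ax xp; apply: zero => //; first by rewrite (le_trans xp) // (le_trans (ltW pq)).
  by move=> y /andP[_ yx]; rewrite ltNge (le_trans yx).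
have mid x : p <= x <= q -> cint a x u = F x.
  move=> /[dup] /andP[px xq] xpq.
  rewrite (@cint_split _ p) ?ap // low // add0r.
  rewrite (@eq_cint _ p x u v) => [|y /andP[py yx]]; last by rewrite uv // py (le_trans yx).
  by rewrite -(primE pq) // (FTC2_prim pq dF) // Fp subr0.
split=> x.
  move=> /[dup] /andP[px xq] xpq.
  by rewrite primE ?mid // (le_trans ap) // (le_trans xq).
move=> /[dup] /andP[ax xb] xab; rewrite negb_and -!leNgt primE // => /orP[xp|qx].
  exact: low.
rewrite (@cint_split _ q) ?(le_trans ap) ?(ltW pq) // mid ?(ltW pq) ?lexx // Fq add0r.
by apply: zero => //; [rewrite (le_trans ap) // ltW|move=> y /andP[qy _]; rewrite andbC ltNge qy].
Qed.

(** For length [l = q - p], the quotient of [4 l^9], bounding the integral of [f''^2], by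
    [l^13 / (2 * 16^6)], the lower bound for that of [f^2] from the middle half, is
    [bump_const * l^-4]. *)
Definition bump_const : R := 8 * 16 ^+ 6.

Lemma bump_exists p q : a <= p -> p < q -> q <= b -> exists u : cfun R,
  [/\ clamped ab u,
    forall x, a <= x <= b -> ~~ (p < x < q) -> u x = 0 /\ L u x = 0,
    dot u u <= bump_const * (q - p) ^- 4 * dot (L u) (L u) &
    0 < dot (L u) (L u)].
Proof.
move=> ap pq qb.
(* [bump2] vanishes at [p] and [q], so freezing it there extends it by zero; the cube is the
   smallest power with this property. *)
have cu : continuous (bump2 p q \o clamp p q).
  apply: within_clamp_continuous; first exact: ltW.
  by apply: continuous_subspaceT; exact: bump2_continuous.
pose u := mkcfun cu; pose v2 := mkcfun (@bump2_continuous p q).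
pose v1 := mkcfun (@bump1_continuous p q).
have u0 x : ~~ (p < x < q) -> u x = 0.
  rewrite negb_and -!leNgt => /orP[xp|qx] /=.
    rewrite /clamp (min_idPr (le_trans xp (ltW pq))) (max_idPl xp).
    by rewrite bump2E subrr; ring.
  by rewrite /clamp (min_idPl qx) (max_idPr (ltW pq)) bump2E subrr; ring.
have [Ju Ju0] := @prim_supp u v2 (bump1 p q) p q ap pq qb
  (fun x xpq => congr1 (bump2 p q) (clamp_id xpq)) (fun x _ => @u0 x)
  (is_derive_bump1 p q) ltac:(by rewrite bump1E subrr; ring)
  ltac:(by rewrite bump1E subrr; ring).
have [Lu Lu0] := @prim_supp (J u) v1 (bump0 p q) p q ap pq qb Ju Ju0
  (is_derive_bump0 p q) ltac:(by rewrite bump0E subrr; ring)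
  ltac:(by rewrite bump0E subrr; ring).
have bab : a <= b <= b by rewrite lexx (ltW ab).
have bpq : ~~ (p < b < q) by rewrite negb_and -!leNgt qb orbT.
have l0 : 0 < q - p by rewrite subr_gt0.
have up : dot u u <= 4 * (q - p) ^+ 8 * (q - p).
  rewrite cdotE; apply: cint_bump => // [|x xpq|x xab xpq]; first exact: ltW.
    by rewrite cmulE -expr2 /= clamp_id // bump2_le.
  by rewrite cmulE u0 // mulr0.
have lo : (q - p) ^+ 12 / 16 ^+ 6 * ((q - p) / 2) <= dot (L u) (L u).
  have -> : (q - p) / 2 = (q - (q - p) / 4) - (p + (q - p) / 4) by field.
  rewrite cdotE; apply: cint_lower.
  - lra.
  - lra.
  - lra.
  - move=> x /[dup] xpq /andP[px xq]; rewrite cmulE -expr2 [L u x]Lu ?bump0_ge //.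
    by apply/andP; split; lra.
  - by move=> x _; rewrite cmulE -expr2 sqr_ge0.
exists u; split.
- by split; [exact: Ju0|exact: Lu0].
- by move=> x xab xpq; split; [exact: u0|exact: Lu0].
- apply: (le_trans up).
  have c0 : 0 <= bump_const * (q - p) ^- 4.
    by rewrite mulr_ge0 ?invr_ge0 ?exprn_ge0 ?(ltW l0) // mulr_ge0 ?exprn_ge0.
  apply: le_trans (ler_wpM2l c0 lo).
  rewrite le_eqVlt; apply/orP; left; apply/eqP; rewrite /bump_const.
  by field; rewrite gt_eqF.
- by apply: lt_le_trans lo; rewrite mulr_gt0 ?divr_gt0 ?exprn_gt0.
Qed.

(** [n + 1] bumps on equal subintervals have disjoint supports, so both quadratic forms are diagonal
    on their span. Part (ii) uses a fixed interval, part (iii) the case [n = 0] on an interval that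
    shrinks with [e]. *)
Lemma eig_upper (U P : R -> R) (V : cfun R) (lam : nat -> R) n p q (m : R) :
  (forall x, a <= x <= b -> V x = U x + P x) ->
  eigenvalue_enum a b (op_graph a b U P) lam ->
  a <= p -> p < q -> q <= b -> (forall x, p <= x <= q -> V x <= m) ->
  lam n <= bump_const * ((q - p) / n.+1%:R) ^- 4 + m.
Proof.
move=> VE en ap pq qb Vm.
pose l := (q - p) / n.+1%:R.
have n0 : 0 < n.+1%:R :> R by rewrite ltr0n.
have l0 : 0 < l by rewrite divr_gt0 // subr_gt0.
pose pp (i : nat) := p + i%:R * l.
have ppS i : pp i.+1 - pp i = l by rewrite /pp -natr1; ring.
have ppn : pp n.+1 = q by rewrite /pp /l; field; rewrite gt_eqF.
have pp_le i j : (i <= j)%N -> pp i <= pp j.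
  by move=> ij; rewrite lerD2l ler_wpM2r ?(ltW l0) // ler_nat.
have pp0 : pp 0%N = p by rewrite /pp mul0r addr0.
have /choice [u uP] (i : 'I_n.+1) : exists u : cfun R,
  [/\ clamped ab u,
    forall x, a <= x <= b -> ~~ (pp i < x < pp i.+1) -> u x = 0 /\ L u x = 0,
    dot u u <= bump_const * l ^- 4 * dot (L u) (L u) &
    0 < dot (L u) (L u)].
  rewrite -(ppS i); apply: bump_exists.
  - by rewrite (le_trans ap) // -pp0 pp_le.
  - by rewrite -subr_gt0 ppS.
  - by rewrite (le_trans _ qb) // -ppn pp_le.
have disj (i j : 'I_n.+1) x : i != j -> ~~ (pp i < x < pp i.+1) \/ ~~ (pp j < x < pp j.+1).
  move=> ij; have [xi|] := boolP (pp i < x < pp i.+1); last by left.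
  right; apply/negP => /andP[jx xj]; case/andP: xi => ix xi.
  move: ij; rewrite -val_eqE neq_ltn => /orP[ij|ji].
    by have := lt_le_trans xi (le_trans (pp_le _ _ ij) (ltW jx)); rewrite ltxx.
  by have := lt_le_trans xj (le_trans (pp_le _ _ ji) (ltW ix)); rewrite ltxx.
have dotz (f g : cfun R) : (forall x, a <= x <= b -> f x = 0 \/ g x = 0) -> dot f g = 0.
  move=> fg; rewrite cdotE -(linear0 (cint a b)); apply: eq_cint => x xab.
  by rewrite cmulE cfun0E; have [->|->] := fg x xab; rewrite ?mul0r ?mulr0.
have du i j : i != j -> dot (u i) (u j) = 0.
  move=> ij; apply: dotz => x xab; have [_ ui _ _] := uP i; have [_ uj _ _] := uP j.
  by have [/ui[]|/uj[]] := disj i j x ij; [|left|..|right].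
have dL i j : i != j -> dot (L (u i)) (L (u j)) = 0.
  move=> ij; apply: dotz => x xab; have [_ ui _ _] := uP i; have [_ uj _ _] := uP j.
  by have [/ui[]|/uj[]] := disj i j x ij; [|left|..|right].
have sq (f : 'I_n.+1 -> cfun R) (c : 'I_n.+1 -> R) :
    (forall i j, i != j -> dot (f i) (f j) = 0) ->
    dot (\sum_i c i *: f i) (\sum_i c i *: f i) = \sum_i c i ^+ 2 * dot (f i) (f i).
  move=> df; rewrite cdot_comb; apply: eq_bigr => i _.
  rewrite cdotC cdot_comb (bigD1 i) //= big1 ?addr0 ?mulrA ?expr2 // => j ji.
  by rewrite df // mulr0.
apply: (@eig_le _ _ _ ab _ _ _ VE _ en n _ u).
- by move=> i; have [] := uP i.
- move=> c /=; set w := \sum_(i < n.+1) c i *: u i.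
  rewrite cenergyE mulrDl; apply: lerD.
    rewrite {1 2}/w sq // /w prim2_sum sq // mulr_sumr; apply: ler_sum => i _.
    rewrite mulrCA ler_wpM2l ?sqr_ge0 //.
    by have [] := uP i.
  apply: cdot_pot_le => x xab.
  have [xpq|xpq] := boolP (p <= x <= q); first by rewrite ler_wpM2r ?sqr_ge0 // Vm.
  rewrite /w prim2_sum cfun_sumE big1 ?expr0n ?mulr0 // => i _.
  rewrite cfunZE; have [_ ui _ _] := uP i; rewrite (ui x xab _).2 ?mulr0 //.
  apply: contra xpq => /andP[h1 h2]; apply/andP; split.
    by apply: le_trans (ltW h1); rewrite -pp0 pp_le.
  by apply: le_trans (ltW h2) _; rewrite -ppn pp_le.
- move=> c /=; rewrite prim2_sum sq // => /eqP; rewrite psumr_eq0; last first.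
    by move=> i _; rewrite mulr_ge0 ?sqr_ge0 ?cdot_ge0.
  move=> /allP c0 i; have := c0 i (mem_index_enum i); have [_ _ _ Ni] := uP i.
  by rewrite /= mulf_eq0 (gt_eqF Ni) orbF sqrf_eq0 => /eqP.
Qed.

End Bump.
(** * The singular potential *)

Section TestFunctions.
Context {R : realType}.
Implicit Types (f : R -> R) (x y e : R).

Lemma near_right (d : R) (Q : R -> Prop) : 0 < d ->
  (forall e, 0 < e -> e < d -> Q e) -> \forall e \near 0^'+, Q e.
Proof.
move=> d0 h; near=> e; apply: h; near: e; first exact: nbhs_right_gt.
exact: nbhs_right_lt.
Unshelve. all: by end_near.
Qed.

Lemma test_fun_continuous f : test_fun f -> continuous f.
Proof.
by move=> [df _] x; apply/differentiable_continuous/derivable1_diffP; exact: (df 0%N).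
Qed.

Lemma test_fun0 f x : test_fun f -> 1 < `|x| -> f x = 0.
Proof.
move=> [_ sf] x1; apply: contrapT => /eqP fx.
have /sf : tsupp f x by exact: subset_closure.
by rewrite /= in_itv /= -ler_norml leNgt x1.
Qed.

Lemma test_fun_derive0 f x : test_fun f -> 1 < `|x| -> derive1 f x = 0.
Proof.
move=> tf x1; rewrite derive1E (@near_eq_derive _ _ _ f (cst 0) x 1) ?derive_cst //.
have : \forall y \near x, 1 < `|y|.
  have : {for x, continuous (fun y : R => `|y|)} by exact: norm_continuous.
  by move=> /cvgr_gt; apply.
by apply: filterS => y y1 /=; exact: test_fun0.
Qed.

Lemma bounded_of_supp f : continuous f -> (forall x, 1 < `|x| -> f x = 0) ->
  exists2 k : R, 0 <= k & forall x, `|f x| <= k.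
Proof.
move=> cf f0; have [k k0 fk] := @cfun_bounded R (- 1) 1 ltac:(lra) (mkcfun cf).
exists k => // x; have [x1|/f0 ->] := leP `|x| 1; last by rewrite normr0.
by apply: fk; rewrite -ler_norml.
Qed.

Lemma test_fun_bounded f : test_fun f -> exists2 k : R, 0 <= k & forall x, `|f x| <= k.
Proof.
move=> tf; apply: bounded_of_supp; first exact: test_fun_continuous.
by move=> x; exact: test_fun0.
Qed.

Lemma test_fun_lipschitz f : test_fun f ->
  exists2 k : R, 0 <= k & forall x y, `|f x - f y| <= k * `|x - y|.
Proof.
move=> tf; have [df _] := tf.
have [k k0 fk] : exists2 k : R, 0 <= k & forall x, `|derive1 f x| <= k.
  apply: bounded_of_supp; last by move=> x; exact: test_fun_derive0.
  move=> x; apply/differentiable_continuous/derivable1_diffP.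
  by have := df 1%N x; rewrite derive1n1.
exists k => // x y; wlog xy : x y / x < y.
  move=> h; have [/h//|/h|->] := ltgtP x y; last by rewrite !subrr normr0 mulr0.
  by rewrite distrC (distrC y).
have [z _ fz] : exists2 z, z \in `]x, y[ & f y - f x = derive1 f z * (y - x).
  apply: MVT => // [z _|].
    by rewrite derive1E; apply: derivableP; exact: (df 0%N).
  by apply: continuous_subspaceT; exact: test_fun_continuous.
by rewrite distrC fz normrM (distrC x) ler_wpM2r.
Qed.

Lemma dilation_continuous f e : continuous f -> continuous (fun x => f (x / e)).
Proof.
move=> cf x; apply: (@continuous_comp _ _ _ (fun x => x / e) f); last exact: cf.
by apply: cvgM; [exact: cvg_id|exact: cvg_cst].
Qed.

Lemma exprN_cvg (n : nat) e : e != 0 -> d ^- n @[d --> e] --> e ^- n.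
Proof.
move=> e0; rewrite -exprVn.
rewrite (_ : (fun d => d ^- n) = (fun d : R => d^-1 ^+ n)); last first.
  by apply/funext => d; rewrite exprVn.
have h : d^-1 @[d --> e] --> e^-1 by apply: cvgV => //; exact: cvg_id.
exact: (cvg_comp (fun d : R => d^-1) (fun y => y ^+ n) h (@exprn_continuous R n e^-1)).
Qed.

(** The change of the prefactor is controlled by the bound on [f], the change of the argument by its
    Lipschitz constant; [|x| <= X] makes the latter uniform in [x]. *)
Lemma scale_diff f (X e0 : R) (n : nat) : test_fun f -> 0 <= X -> e0 != 0 ->
  exists phi : R -> R, phi e @[e --> e0] --> 0 /\
    forall e x, `|x| <= X -> `|e ^- n * f (x / e) - e0 ^- n * f (x / e0)| <= phi e.
Proof.
move=> tf X0 e00; have [k k0 fk] := test_fun_bounded tf.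
have [l l0 fl] := test_fun_lipschitz tf.
exists (fun e => `|e ^- n - e0 ^- n| * k + `|e0 ^- n| * (l * (X * `|e^-1 - e0^-1|))).
have dist0 (j : nat) : `|e ^- j - e0 ^- j| @[e --> e0] --> 0.
  rewrite -(normr0 R) -(subrr (e0 ^- j)); apply: cvg_norm; apply: cvgB.
    exact: exprN_cvg.
  exact: cvg_cst.
split.
  have -> : 0 = 0 * k + `|e0 ^- n| * (l * (X * 0)) :> R by rewrite !(mulr0, mul0r) addr0.
  apply: cvgD; first by apply: cvgM; [exact: dist0|exact: cvg_cst].
  by do 3! (apply: cvgM; first exact: cvg_cst); exact: (dist0 1%N).
move=> e x xX.
have -> : e ^- n * f (x / e) - e0 ^- n * f (x / e0) =
  (e ^- n - e0 ^- n) * f (x / e) + e0 ^- n * (f (x / e) - f (x / e0)) by ring.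
rewrite (le_trans (ler_normD _ _)) // !normrM lerD ?ler_wpM2l //.
rewrite (le_trans (fl _ _)) // ler_wpM2l // -mulrBr normrM ler_wpM2r //.
Qed.

Lemma expVn_le e (m n : nat) : 0 < e -> e < 1 -> (m <= n)%N -> e ^- m <= e ^- n.
Proof.
move=> e0 e1 mn; rewrite -!exprVn; apply: ler_weXn2l => //.
by rewrite invf_ge1 // ltW.
Qed.

Lemma scale_term_le f (k g e x : R) (m n : nat) : (forall x, `|f x| <= k) -> 0 <= k ->
  0 < e -> e < 1 -> (m <= n)%N -> `|g * e ^- m * f (x / e)| <= `|g| * k * e ^- n.
Proof.
move=> fk k0 e0 e1 mn.
have em : 0 <= e ^- m by rewrite invr_ge0 exprn_ge0 // ltW.
rewrite !normrM (ger0_norm em) -!mulrA ler_wpM2l // [k * _]mulrC.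
by rewrite ler_pM // expVn_le.
Qed.

Lemma positive_interval f x : continuous f -> 0 < f x ->
  exists p q s : R, [/\ p < q, 0 < s & forall y, p <= y <= q -> s <= f y].
Proof.
move=> cf fx; have : \forall y \near x, f x / 2 < f y.
  have : f x / 2 < f x by lra.
  by move: (cf x) => /cvgr_gt; apply.
move=> /nbhs_ballP[d /= d0 hd]; exists (x - d / 2), (x + d / 2), (f x / 2).
split; [lra|lra|] => y /andP[h1 h2]; apply/ltW/hd.
by rewrite /ball /= ltr_norml; apply/andP; split; lra.
Qed.

End TestFunctions.

(** * The perturbed operators *)

Lemma smooth_on_cfun (R : realType) (a b : R) (U : R -> R) : a < b ->
  smooth_on a b U -> exists W : cfun R, forall x, a <= x <= b -> W x = U x.
Proof.
move=> ab [D [D0 cD _]].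
exists (mkcfun (within_clamp_continuous (ltW ab) (cD 0%N))) => x xab /=.
by rewrite clamp_id // D0 // in_itv.
Qed.

Section PerturbedOperator.
Context {R : realType}.
Variables (a b : R) (U Psi Phi Ups1 Ups2 : R -> R) (alpha beta gamma1 gamma2 : R).
Hypothesis a0 : a < 0.
Hypothesis b0 : 0 < b.
Hypothesis tPsi : test_fun Psi.
Hypothesis tPhi : test_fun Phi.
Hypothesis tUps1 : test_fun Ups1.
Hypothesis tUps2 : test_fun Ups2.
Let ab : a < b := lt_trans a0 b0.
Notation Pe := (Psi_eps Psi Phi Ups1 Ups2 alpha beta gamma1 gamma2).

Lemma Psi_eps_continuous e : continuous (Pe e).
Proof.
have st (g : R) (f : R -> R) : test_fun f -> continuous (fun x : R => g * f (x / e)).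
  move=> tf x; have h := @dilation_continuous _ f e (test_fun_continuous tf) x.
  exact: (cvgM (cvg_cst g) h).
by move=> x; apply: cvgD; [apply: cvgD; [apply: cvgD|]|]; exact: st.
Qed.

Lemma Psi_eps0 e x : 0 < e -> e < `|x| -> Pe e x = 0.
Proof.
move=> e0 ex; have x1 : 1 < `|x / e|.
  by rewrite normrM normfV (gtr0_norm e0) ltr_pdivlMr // mul1r.
rewrite /Psi_eps (test_fun0 tPsi x1) (test_fun0 tPhi x1) (test_fun0 tUps1 x1).
by rewrite (test_fun0 tUps2 x1) !mulr0 !addr0.
Qed.

(** The crude bound of order [e ^- 4] serves (iv). The second isolates the leading term, whose sign
    matters in (iii), from a remainder of lower order. *)
Lemma Psi_eps_split : exists2 k : R, 0 <= k & forall e x, 0 < e -> e < 1 ->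
  `|Pe e x| <= k * e ^- 4 /\
  Pe e x <= alpha * Psi (x / e) * e ^- 4 + k * e ^- 3.
Proof.
have [k1 k10 h1] := test_fun_bounded tPsi; have [k2 k20 h2] := test_fun_bounded tPhi.
have [k3 k30 h3] := test_fun_bounded tUps1; have [k4 k40 h4] := test_fun_bounded tUps2.
exists (`|alpha| * k1 + (`|beta| * k2 + `|gamma1| * k3 + `|gamma2| * k4)).
  by rewrite !addr_ge0 // mulr_ge0.
move=> e x e0 e1.
have e30 : 0 <= e ^- 3 by rewrite invr_ge0 exprn_ge0 // ltW.
have t1 := scale_term_le alpha x h1 k10 e0 e1 (leqnn 4).
have t2 := scale_term_le beta x h2 k20 e0 e1 (leqnn 3).
have t3 := scale_term_le gamma1 x h3 k30 e0 e1 (isT : (2 <= 3)%N).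
have t4 : `|gamma2 * e^-1 * Ups2 (x / e)| <= `|gamma2| * k4 * e ^- 3.
  exact: (scale_term_le gamma2 x h4 k40 e0 e1 (isT : (1 <= 3)%N)).
have A0 : 0 <= `|alpha| * k1 by rewrite mulr_ge0.
have B0 : 0 <= `|beta| * k2 + `|gamma1| * k3 + `|gamma2| * k4.
  by rewrite !addr_ge0 // mulr_ge0.
have rest : `|beta * e ^- 3 * Phi (x / e) + gamma1 * e ^- 2 * Ups1 (x / e)
    + gamma2 * e^-1 * Ups2 (x / e)|
    <= (`|beta| * k2 + `|gamma1| * k3 + `|gamma2| * k4) * e ^- 3.
  by rewrite !mulrDl (le_trans (ler_normD _ _)) // lerD // (le_trans (ler_normD _ _)) // lerD.
move: rest; set r := (X in `|X| <= _) => rest.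
have -> : Pe e x = alpha * e ^- 4 * Psi (x / e) + r by rewrite /Psi_eps /r !addrA.
split.
  rewrite (le_trans (ler_normD _ _)) // [leRHS]mulrDl lerD // (le_trans rest) //.
  by rewrite ler_wpM2l // expVn_le.
rewrite (mulrAC alpha) lerD2l (le_trans (ler_norm _)) // (le_trans rest) //.
by rewrite ler_wpM2r // lerDr.
Qed.

Lemma Psi_eps_uniform (X e0 : R) : 0 <= X -> e0 != 0 ->
  exists phi : R -> R, phi e @[e --> e0] --> 0 /\
    forall e x, `|x| <= X -> `|Pe e x - Pe e0 x| <= phi e.
Proof.
move=> X0 e00.
have [f1 [c1 h1]] := scale_diff 4 tPsi X0 e00.
have [f2 [c2 h2]] := scale_diff 3 tPhi X0 e00.
have [f3 [c3 h3]] := scale_diff 2 tUps1 X0 e00.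
have [f4 [c4 h4]] := scale_diff 1 tUps2 X0 e00.
exists (fun e => `|alpha| * f1 e + `|beta| * f2 e + `|gamma1| * f3 e + `|gamma2| * f4 e).
split.
  have hm (g : R) (f : R -> R) : f e @[e --> e0] --> 0 -> `|g| * f e @[e --> e0] --> 0.
    by move=> cf; have := cvgM (cvg_cst `|g|) cf; rewrite mulr0; apply.
  have := cvgD (cvgD (cvgD (hm alpha _ c1) (hm beta _ c2)) (hm gamma1 _ c3)) (hm gamma2 _ c4).
  by rewrite !addr0; apply.
move=> e x xX.
have -> : Pe e x - Pe e0 x =
    alpha * (e ^- 4 * Psi (x / e) - e0 ^- 4 * Psi (x / e0))
  + beta * (e ^- 3 * Phi (x / e) - e0 ^- 3 * Phi (x / e0))
  + gamma1 * (e ^- 2 * Ups1 (x / e) - e0 ^- 2 * Ups1 (x / e0))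
  + gamma2 * (e ^- 1 * Ups2 (x / e) - e0 ^- 1 * Ups2 (x / e0)).
  by rewrite /Psi_eps !expr1; move: (e ^- 4) (e0 ^- 4) (e ^- 3) (e0 ^- 3)
    (e ^- 2) (e0 ^- 2) (e^-1) (e0^-1) => *; ring.
have hn (g A f : R) : `|A| <= f -> `|g * A| <= `|g| * f.
  by move=> Af; rewrite normrM ler_wpM2l.
do 3! (apply: le_trans (ler_normD _ _) _; apply: lerD;
  last by apply: hn; (exact: h2 || exact: h3 || exact: h4)).
by apply: hn; exact: h1.
Qed.

Variable W : cfun R.
Hypothesis WE : forall x, a <= x <= b -> W x = U x.
Variable lam : nat -> R -> R.
Hypothesis en : forall e : R, 0 < e < 1 ->
  eigenvalue_enum a b (op_graph a b U (Pe e)) (lam^~ e).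

Definition potential e : cfun R := W + mkcfun (@Psi_eps_continuous e).

Lemma potentialE e x : a <= x <= b -> potential e x = U x + Pe e x.
Proof. by move=> xab; rewrite cfunDE WE. Qed.

Lemma eigenvalue_continuous k : {in `]0, 1[, continuous (lam k)}.
Proof.
move=> e0; rewrite in_itv /= => e01; have [e00 _] := andP e01.
pose X : R := `|a| + `|b|.
have X0 : 0 <= X by rewrite addr_ge0.
have [phi [cphi hphi]] := Psi_eps_uniform X0 (lt0r_neq0 e00).
have hX x : a <= x <= b -> `|x| <= X.
  move=> /andP[ax xb]; rewrite ler_norml /X.
  rewrite (ltr0_norm a0) (gtr0_norm b0); have := a0; have := b0 => hb ha.
  by apply/andP; split; lra.
apply/cvgrPdist_le => d d0.
have n1 : \forall e \near e0, 0 < e < 1.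
  have : e0 \in `]0, 1[ by rewrite in_itv.
  by move=> /near_in_itvoo; apply: filterS => e; rewrite in_itv.
have n2 : \forall e \near e0, phi e < d by move/cvgr_lt : cphi; apply.
apply: filterS (filterI n1 n2) => e [e1 pd].
have shift e1' e2' : 0 < e1' < 1 -> 0 < e2' < 1 ->
    (forall x, `|x| <= X -> `|Pe e2' x - Pe e1' x| <= d) -> lam k e2' <= lam k e1' + d.
  move=> h1 h2 hd.
  apply: (eig_shift ab k (potentialE e1') (potentialE e2') (en h1) (en h2)).
  move=> x /hX /hd; rewrite ler_norml => /andP[_ h].
  by rewrite !cfunDE -addrA lerD2l -lerBlDl.
have s1 : lam k e <= lam k e0 + d.
  by apply: shift => // x /hphi h; rewrite (le_trans (h _)) // ltW.
have s2 : lam k e0 <= lam k e + d.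
  by apply: shift => // x /hphi h; rewrite distrC (le_trans (h _)) // ltW.
by rewrite ler_norml; apply/andP; split; lra.
Qed.

Lemma eigenvalue_bounded_above k : exists M : R, \forall e \near 0^'+, lam k e <= M.
Proof.
have [C C0 WC] := cfun_bounded ab W.
exists (bump_const * ((b - b / 2) / k.+1%:R) ^- 4 + C).
apply: (@near_right _ (Num.min 1 (b / 2))) => [|e e0].
  by rewrite lt_min ltr01 divr_gt0.
rewrite lt_min => /andP[e1 eb].
have e01 : 0 < e < 1 by rewrite e0.
apply: (eig_upper ab k (potentialE e) (en e01)) => [|||x /andP[bx xb]];
  try (have := a0; have := b0; lra).
rewrite cfunDE /= Psi_eps0 // ?addr0; last first.
  by rewrite (lt_le_trans eb) // (le_trans bx) // ler_norm.
rewrite (le_trans (ler_norm _)) // WC // xb andbT.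
by have := a0; have := b0; lra.
Qed.

(** A single bump on [[e p, e q]] has energy quotient [bump_const (q - p)^-4 e^-4], against at most
    [- |alpha| s e^-4] from the leading part of the potential. *)
Lemma first_eigenvalue_le (p q s : R) : p < q -> 0 < s ->
  (forall y, p <= y <= q -> alpha * Psi y <= - (`|alpha| * s)) ->
  bump_const * (q - p) ^- 4 / s < `|alpha| ->
  exists2 c : R, 0 < c & \forall e \near 0^'+, lam 0%N e <= - c * e ^- 4.
Proof.
move=> pq s0 hs big.
have [C C0 WC] := cfun_bounded ab W.
have [k k0 hk] := Psi_eps_split.
(* Half of the margin; the other half absorbs the [e ^- 3] remainder and the bounded [W]. *)
pose c := (`|alpha| * s - bump_const * (q - p) ^- 4) / 2.
have c0 : 0 < c by rewrite divr_gt0 // subr_gt0 -ltr_pdivrMr.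
exists c => //.
(* [e * m] below [- a] and [b] keeps [[e p, e q]] inside [[a, b]]. *)
pose m := `|p| + `|q| + 1.
have m0 : 0 < m by rewrite ltr_wpDl // addr_ge0.
have D0 : 0 < k + C + 1 by rewrite ltr_wpDl // addr_ge0.
apply: (@near_right _ (Num.min (Num.min 1 (c / (k + C + 1))) (Num.min (- a / m) (b / m)))).
  have da : 0 < - a / m by apply: divr_gt0 => //; rewrite oppr_gt0.
  by rewrite !lt_min ltr01 (divr_gt0 c0 D0) (divr_gt0 b0 m0) da.
move=> e e0; rewrite !lt_min (ltr_pdivlMr _ _ D0) !(ltr_pdivlMr _ _ m0).
move=> /andP[/andP[e1 ec] /andP[ea eb]].
have e01 : 0 < e < 1 by rewrite e0.
have em z : `|z| <= m -> a <= e * z <= b.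
  move=> zm; have : `|e * z| <= e * m by rewrite normrM gtr0_norm // ler_wpM2l // ltW.
  by rewrite ler_norml => /andP[h1 h2]; apply/andP; split; lra.
have pm : `|p| <= m by rewrite /m; have := normr_ge0 q; lra.
have qm : `|q| <= m by rewrite /m; have := normr_ge0 p; lra.
have /andP[ap _] := em p pm; have /andP[_ qb] := em q qm.
have epq : e * p < e * q by rewrite ltr_pM2l.
have e4 : 0 < e ^- 4 by rewrite invr_gt0 exprn_gt0.
have e3 : 0 < e ^- 3 by rewrite invr_gt0 exprn_gt0.
have := @eig_upper _ a b ab U (Pe e) (potential e) _ 0%N (e * p) (e * q)
  (C - `|alpha| * s * e ^- 4 + k * e ^- 3) (@potentialE e) (en e01) ap epq qb.
have -> : (e * q - e * p) / 1 = e * (q - p) by rewrite divr1 mulrBr.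
move=> H; apply: le_trans (H _) _ => [x xpq|].
  have xab : a <= x <= b.
    by case/andP: xpq => h1 h2; rewrite (le_trans ap) // (le_trans h2).
  have [_ hx] := hk e x e0 e1.
  have ye : p <= x / e <= q by rewrite ler_pdivlMr // ler_pdivrMr // !(mulrC _ e).
  have h1 : alpha * Psi (x / e) * e ^- 4 <= - (`|alpha| * s * e ^- 4).
    by rewrite -mulNr ler_wpM2r ?hs // ltW.
  have h2 : W x <= C by rewrite (le_trans (ler_norm _)) // WC.
  by rewrite cfunDE [mkcfun _ x](_ : _ = Pe e x) //; lra.
have -> : bump_const * (e * (q - p)) ^- 4 = bump_const * (q - p) ^- 4 * e ^- 4.
  by rewrite exprMn invfM mulrCA mulrC.
have small : (k + C) * e ^- 3 <= c * e ^- 4.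
  have -> : (k + C) * e ^- 3 = ((k + C) * e) * e ^- 4 by field; rewrite gt_eqF.
  have kC : (k + C) * e <= c.
    rewrite (le_trans _ (ltW ec)) // mulrC; apply: ler_wpM2l; first exact: ltW.
    by rewrite lerDl.
  by rewrite ler_wpM2r // ltW.
have C3 : C <= C * e ^- 3.
  rewrite ler_peMr //; have := @expVn_le _ e 0 3 e0 e1 isT.
  by rewrite expr0 invr1.
have cE : 2 * c = `|alpha| * s - bump_const * (q - p) ^- 4 by rewrite /c mulrC divfK.
have : (2 * c) * e ^- 4 = `|alpha| * s * e ^- 4 - bump_const * (q - p) ^- 4 * e ^- 4.
  by rewrite cE mulrBl.
move: small; rewrite mulrDl; lra.
Qed.

(** For the right-hand side 0, an eigenfunction and 0 both solve the resolvent equation, which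
    contradicts uniqueness. *)
Lemma eigenvalue_in_spectrum e k : 0 < e < 1 ->
  spectrum a b (op_graph a b U (Pe e)) (lam k e)%:C.
Proof.
move=> e01 [C /(_ (fun=> 0)) []].
  have [m1 m2] := @L2_cfun R a b 0; rewrite /L2normsq /= => fin.
  by split.
move=> f [_ _ uniq_f].
have [g [eg og]] := eigenfamily_exists ab (potentialE e) (en e01) k.+1.
have graph h : reig ab (potential e) (lam k e) h ->
    op_graph a b U (Pe e) (fun x => (prim2 ab h x)%:C)
      (fun x => (lam k e)%:C * (prim2 ab h x)%:C + 0).
  move=> eh; have := graph_of_reig (potentialE e) eh.
  by under [X in _ -> op_graph _ _ _ _ _ X]eq_fun do rewrite addr0.
have h1 := uniq_f _ (graph _ (eg k (ltnSn k))).
have h2 := uniq_f _ (graph _ (reig0 ab _ _)).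
have := og k k (ltnSn k) (ltnSn k); rewrite eqxx.
have gz x : a <= x <= b -> prim2 ab (g k) x = (0 : cfun R) x.
  move=> xab; have := h1 x; rewrite in_itv => /(_ xab).
  rewrite -(h2 x) ?in_itv // => -[->].
  by rewrite (_ : prim2 ab 0 = 0) //; exact: linear0.
rewrite (eq_cdot gz gz) (dot0l (@cdotl _ a b)) => /eqP.
by rewrite eq_sym oner_eq0.
Qed.

Lemma eigenvalue_bounded_below : exists (n : nat) (C : R),
  \forall e \near 0^'+, forall k, (n <= k)%N -> - C <= lam k e.
Proof.
have [C C0 WC] := cfun_bounded ab W.
have [K K0 hK] := Psi_eps_split.
(* The condition in [eig_lower] is [K e^-4 (4 e / N)^3 (4 e) = 256 K / N^3 <= 1], whence 256. *)
pose N := (Num.truncn (256 * K)).+1.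
have N0 : 0 < N%:R :> R by rewrite ltr0n.
have NK : 256 * K <= N%:R by exact/ltW/truncnS_gt.
exists (N.+1 + N.+1)%N, C.
apply: (@near_right _ (Num.min 1 (Num.min (- a / 2) (b / 2)))).
  by rewrite !lt_min ltr01 !divr_gt0 // oppr_gt0.
move=> e e0; rewrite !lt_min => /andP[e1 /andP[ea eb]] k nk.
have e01 : 0 < e < 1 by rewrite e0.
apply: le_trans (lam_mono (en e01) nk).
pose d := 4 * e / N%:R.
have d0 : 0 < d by rewrite divr_gt0 // mulr_gt0.
have dN : N%:R * d = 4 * e by rewrite /d mulrC divfK // gt_eqF.
(* The [N + 1] nodes with step [4 e / N] run from [- 2 e] to [2 e], both ends included. *)
apply: (@eig_lower _ a b ab U (Pe e) (potential e) (@potentialE e) _ (en e01) N.+1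
  W (mkcfun (@Psi_eps_continuous e)) (fun i => - (2 * e) + i%:R * d)
  (- (2 * e)) (2 * e) (K * e ^- 4) C d) => //; try (have := a0; have := b0; lra).
- by rewrite mulr_ge0 // invr_ge0 exprn_ge0 // ltW.
- by move=> x _ /=; have [] := hK e x e0 e1.
(* [Psi_eps0] needs [e < |x|] strictly while the ends of the interval belong to the complement; the
   radius [2 e] leaves the room. *)
- move=> x xe; apply: Psi_eps0 => //.
  have {xe} : ~~ (`|x| < 2 * e) by rewrite ltr_norml.
  by rewrite -leNgt; apply: lt_le_trans; lra.
- move=> i; have iN : i%:R * d <= N%:R * d.
    by rewrite ler_wpM2r ?(ltW d0) // ler_nat -ltnS.
  have i0 : 0 <= i%:R * d by rewrite mulr_ge0 // ltW.
  by apply/andP; split; lra.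
- move=> x /andP[ex xe].
  have q0 : 0 <= (x + 2 * e) / d by rewrite divr_ge0 ?(ltW d0) //; lra.
  have iN : (Num.truncn ((x + 2 * e) / d) < N.+1)%N.
    rewrite ltnS -[N in (_ <= N)%N](@natrK R); apply: le_truncn.
    by rewrite ler_pdivrMr // dN; lra.
  exists (Ordinal iN) => /=.
  have /andP[h1 h2] := truncn_itv q0.
  move: (Num.truncn _) h1 h2 => i h1 h2.
  rewrite ler_pdivlMr // in h1; rewrite ltr_pdivrMr // -natr1 mulrDl mul1r in h2.
  by rewrite ler_norml; apply/andP; split; lra.
- have -> : K * e ^- 4 * d ^+ 3 * (2 * e - - (2 * e)) = 256 * K / N%:R ^+ 3.
    by rewrite /d; field; rewrite !gt_eqF.
  rewrite ler_pdivrMr ?exprn_gt0 // mul1r (le_trans NK) //.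
  by rewrite ler_eXnr // ler1n.
Qed.

End PerturbedOperator.
(** Depending on the sign of [alpha], the bump sits where [Psi] is positive or where it is negative;
    the larger of the two thresholds serves both. The threshold must exist before the sign change is
    assumed, hence the dummy value 0 otherwise. *)
Lemma sign_threshold (R : realType) (Psi : R -> R) : test_fun Psi ->
  exists alpha0 : R, changes_sign Psi -> forall alpha, alpha0 < `|alpha| ->
    exists p q s : R, [/\ p < q, 0 < s,
      forall y, p <= y <= q -> alpha * Psi y <= - (`|alpha| * s) &
      bump_const * (q - p) ^- 4 / s < `|alpha|].
Proof.
move=> tPsi; have cPsi := test_fun_continuous tPsi.
have [[[x1 h1] [x2 h2]]|nc] := pselect (changes_sign Psi); last by exists 0.
have [p1 [q1 [s1 [pq1 s10 hs1]]]] := positive_interval cPsi h1.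
have cN : continuous (fun x => - Psi x) by move=> x; apply: cvgN; exact: cPsi.
have [p2 [q2 [s2 [pq2 s20 hs2]]]] : exists p q s : R,
    [/\ p < q, 0 < s & forall y, p <= y <= q -> s <= - Psi y].
  by apply: (positive_interval cN (x := x2)); rewrite oppr_gt0.
exists (Num.max (bump_const * (q1 - p1) ^- 4 / s1) (bump_const * (q2 - p2) ^- 4 / s2)).
move=> _ alpha; rewrite gt_max => /andP[b1 b2].
have [al|al] := leP alpha 0.
  exists p1, q1, s1; split => // y /hs1 hy.
  by rewrite (ler0_norm al) mulNr opprK ler_wnM2l.
exists p2, q2, s2; split => // y /hs2 hy.
by rewrite (gtr0_norm al) -mulrN; apply: ler_wpM2l; [exact: ltW|rewrite lerNr].
Qed.

(* The eigenvalue lambda_k of the text, k >= 1, is lam k.-1; the threshold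
   alpha0 of (iii) depends on Psi only. *)
Theorem theorem2p1 (R : realType) (Psi : R -> R)
    (hPsi : test_fun Psi) (hsupp : tsupp Psi = `[-1, 1]%classic) :
  exists alpha0 : R,
  forall (a b : R) (U Phi Ups1 Ups2 : R -> R) (alpha beta gamma1 gamma2 : R),
  a < 0 -> 0 < b -> smooth_on a b U ->
  test_fun Phi -> test_fun Ups1 -> test_fun Ups2 ->
  let S := fun eps : R =>
    op_graph a b U (Psi_eps Psi Phi Ups1 Ups2 alpha beta gamma1 gamma2 eps) in
  forall lam : nat -> R -> R,
  (forall eps, 0 < eps < 1 -> eigenvalue_enum a b (S eps) (lam^~ eps)) ->
  [/\ (* (i) *)
      forall k, {in `]0, 1[, continuous (lam k)},
      (* (ii) *)
      forall k, exists M : R, \forall eps \near 0^'+, lam k eps <= M,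
      (* (iii) *)
      changes_sign Psi -> alpha0 < `|alpha| ->
        (forall M : R, \forall eps \near 0^'+,
           exists2 s : R, spectrum a b (S eps) s%:C & s < M) /\
        (exists2 c : R, 0 < c &
           \forall eps \near 0^'+, lam 0%N eps <= - c * eps ^- 4) &
      (* (iv) *)
      finite_set [set k | lam k eps @[eps --> 0^'+] --> -oo]].
Proof.
have [alpha0 thr] := sign_threshold hPsi; exists alpha0.
move=> a b U Phi Ups1 Ups2 alpha beta gamma1 gamma2 a0 b0 sU hPhi hUps1 hUps2 S lam en.
have ab : a < b := lt_trans a0 b0.
have [W WE] := smooth_on_cfun ab sU.
split.
- by move=> k; exact: (eigenvalue_continuous a0 b0 hPsi hPhi hUps1 hUps2 WE en).
- by move=> k; exact: (eigenvalue_bounded_above a0 b0 hPsi hPhi hUps1 hUps2 WE en).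
- move=> cs /(thr cs) [p [q [s [pq s0 hs big]]]].
  have [c c0 hc] := first_eigenvalue_le a0 b0 hPsi hPhi hUps1 hUps2 WE en pq s0 hs big.
  split; last by exists c.
  move=> M; have M0 : 0 < `|M| + 1 by rewrite ltr_wpDl.
  have small : \forall eps \near 0^'+, 0 < eps < 1 /\ eps * (`|M| + 1) < c.
    apply: (@near_right _ (Num.min 1 (c / (`|M| + 1)))).
      by rewrite lt_min ltr01 divr_gt0.
    by move=> e e0; rewrite lt_min (ltr_pdivlMr _ _ M0) e0 => /andP[-> ->].
  apply: filterS (filterI hc small) => e [le0 [e01 eM]].
  exists (lam 0%N e).
    exact: (eigenvalue_in_spectrum a0 b0 hPsi hPhi hUps1 hUps2 WE en).
  have /andP[e0 e1] := e01.
  have e4 := @expVn_le _ e 1 4 e0 e1 isT; rewrite expr1 in e4.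
  (* As [e < 1], [c e^-4 >= c e^-1 > |M| + 1], so the first eigenvalue is below [M]. *)
  have : `|M| + 1 < c * e^-1 by rewrite ltr_pdivlMr // mulrC.
  have := ler_wpM2l (ltW c0) e4; have := ler_norm (- M); rewrite normrN.
  by move: le0; rewrite mulNr; move: (e ^- 4) (e^-1) => *; lra.
- have [n [C hC]] := eigenvalue_bounded_below a0 b0 hPsi hPhi hUps1 hUps2 WE en.
  apply: (@sub_finite_set _ _ `I_n); last exact: finite_II.
  move=> k /= /cvgrNy_lt hk; rewrite ltnNge; apply/negP => nk.
  apply: (filter_not_empty (0 : R)^'+).
  apply: filterS (filterI hC (hk (- C))) => e [hle hlt].
  by have := lt_le_trans hlt (hle k nk); rewrite ltxx.
Qed.
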